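(* For every pure inner function $\Theta:\mathbb{D}\to\mathcal{L}(\mathbb{C}^N)$, the map $\tau^\Theta:X\to\mathfrak{K}$, $\Omega\mapsto\overline{W(U^\Theta_\Omega)}$, wraps $\overline{W(S_\Theta)}$.
   Context: A bounded analytic $\Theta:\mathbb{D}\to\mathcal{L}(\mathbb{C}^N)$ is inner if its radial boundary values are isometries a.e. on $\mathbb{T}$, and pure if $\|\Theta(0)x\|<\|x\|$ for $x\neq0$. $K_\Theta=H^2(\mathbb{C}^N)\ominus\Theta H^2(\mathbb{C}^N)$, $S_\Theta=P_{K_\Theta}\mathbf{T}_z|_{K_\Theta}$ with $\mathbf{T}_z$ multiplication by $z$ on $H^2(\mathbb{C}^N)$. $D_A=(I-A^*A)^{1/2}$. Define $\iota,\iota_*:\mathbb{C}^N\to K_\Theta$ by $\iota(D_{\Theta(0)}\xi)=\frac1z(\Theta(z)-\Theta(0))\xi$, $\iota_*(D_{\Theta(0)^*}\xi)=(I-\Theta(z)\Theta(0)^* )\xi$ (isometries onto $\mathcal{D}_{S_\Theta}$ and $\mathcal{D}_{S_\Theta^*}$). $X$ is the set of unitary operators on $\mathbb{C}^N$, and for $\Omega\in X$, $U^\Theta_\Omega=\begin{pmatrix} S_\Theta & \iota_*D_{\Theta(0)^*}\Omega\\ D_{\Theta(0)}\iota^* & \Theta(0)^*\Omega\end{pmatrix}$ on $K_\Theta\oplus\mathbb{C}^N$ (a unitary $N$-dilation of $S_\Theta$). $W$ denotes numerical range. $\mathfrak{K}$ is the space of nonempty compact subsets of $\mathbb{C}$ with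 the Hausdorff distance; a continuous $\tau:X\to\mathfrak{K}$ wraps $A\in\mathfrak{K}$ if for each open half-plane $\mathbb{H}\supset A$ there exists $x\in X$ with $\tau(x)\subset\mathbb{H}$. *)

(* Defs.v *)
From mathcomp Require Import all_boot all_algebra.
From mathcomp Require Import all_classical all_reals all_analysis.
From mathcomp Require Import complex.

Set Implicit Arguments.
Unset Strict Implicit.
Unset Printing Implicit Defensive.
Import GRing.Theory Num.Theory numFieldNormedType.Exports.
Local Open Scope ring_scope.
Local Open Scope classical_set_scope.

Section ModelSpaces.
Context (R : realType).
Local Notation C := (complex R).

Definition re (z : C) : R := let: Complex a _ := z in a.
Definition im (z : C) : R := let: Complex _ b := z in b.
Definition cabs2 (z : C) : R := re z ^+ 2 + im z ^+ 2.
Definition cconj (z : C) : C := Complex (re z) (- im z).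
Definition cscale (r : R) (z : C) : C := Complex (r * re z) (r * im z).
Definition expi (t : R) : C := Complex (cos t) (sin t).

Definition csum_cvg (a : nat -> C) : Prop :=
  cvgn (series (fun k => re (a k))) /\ cvgn (series (fun k => im (a k))).
Definition csum (a : nat -> C) : C :=
  Complex (limn (series (fun k => re (a k)))) (limn (series (fun k => im (a k)))).

Definition cclosure (S : set C) : set C :=
  [set z | forall eps : R, 0 < eps -> exists s, S s /\ cabs2 (z - s) < eps].
Definition cbounded (S : set C) : Prop :=
  exists M : R, forall z, S z -> cabs2 z <= M.
Definition open_halfplane (Hp : set C) : Prop :=
  exists (a : C) (c : R), a != 0 /\ Hp = [set z | c < re (cconj a * z)].

Context (N : nat).

Definition vdot (u v : 'cV[C]_N) : C := \sum_i u i 0 * cconj (v i 0).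
Definition vnorm2 (u : 'cV[C]_N) : R := \sum_i cabs2 (u i 0).
Definition adj (M : 'M[C]_N) : 'M[C]_N := \matrix_(i, j) cconj (M j i).
Definition isometry_mx (M : 'M[C]_N) : Prop := adj M *m M = 1%:M.
Definition unitary_mx (M : 'M[C]_N) : Prop :=
  adj M *m M = 1%:M /\ M *m adj M = 1%:M.

(* ---------- H^2(C^N), via Taylor coefficient sequences ---------- *)
Definition H2 := nat -> 'cV[C]_N.
Definition in_H2 (f : H2) : Prop := cvgn (series (fun k => vnorm2 (f k))).
Definition h2dot (f g : H2) : C := csum (fun k => vdot (f k) (g k)).
Definition h2add (f g : H2) : H2 := fun k => f k + g k.
Definition h2sub (f g : H2) : H2 := fun k => f k - g k.
Definition shiftz (f : H2) : H2 := fun k => if k is k'.+1 then f k' else 0.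

(* ---------- bounded analytic Theta : D -> L(C^N), Theta(z) = sum_k A k z^k ---------- *)
Definition in_disk (z : C) : Prop := cabs2 z < 1.
Definition ps_eval (A : nat -> 'M[C]_N) (z : C) : 'M[C]_N :=
  \matrix_(i, j) csum (fun k => A k i j * z ^+ k).
Definition bounded_analytic (A : nat -> 'M[C]_N) : Prop :=
  (forall z, in_disk z -> forall i j, csum_cvg (fun k => A k i j * z ^+ k)) /\
  (exists c : R, forall z, in_disk z -> forall x : 'cV[C]_N,
      vnorm2 (ps_eval A z *m x) <= c * vnorm2 x).
Definition Theta0 (A : nat -> 'M[C]_N) : 'M[C]_N := ps_eval A 0.

Definition radial_limit (A : nat -> 'M[C]_N) (t : R) (B : 'M[C]_N) : Prop :=
  forall eps : R, 0 < eps -> exists delta : R, 0 < delta /\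
    forall r : R, 0 < r -> 1 - delta < r -> r < 1 ->
      forall i j, cabs2 (ps_eval A (cscale r (expi t)) i j - B i j) < eps.

Definition inner_fn (A : nat -> 'M[C]_N) : Prop :=
  bounded_analytic A /\
  exists E : set R, measurable E /\ (lebesgue_measure E = 0)%E /\
    forall t : R, 0 <= t -> t <= 2 * pi -> ~ E t ->
      exists B, radial_limit A t B /\ isometry_mx B.

Definition pure_fn (A : nat -> 'M[C]_N) : Prop :=
  forall x : 'cV[C]_N, x != 0 -> vnorm2 (Theta0 A *m x) < vnorm2 x.

(* (Theta f)(z) = Theta(z) f(z) *)
Definition mulTheta (A : nat -> 'M[C]_N) (f : H2) : H2 :=
  fun k => \sum_(j < k.+1) A j *m f (k - j)%N.

Definition KTheta (A : nat -> 'M[C]_N) : set H2 :=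
  [set g | in_H2 g /\ forall f, in_H2 f -> h2dot g (mulTheta A f) = 0].

Definition is_proj (V : set H2) (y p : H2) : Prop :=
  V p /\ forall g, V g -> h2dot (h2sub y p) g = 0.

(* iota (D_{Theta(0)} xi) = (1/z)(Theta(z) - Theta(0)) xi *)
Definition iotaD (A : nat -> 'M[C]_N) (xi : 'cV[C]_N) : H2 :=
  fun k => A k.+1 *m xi.
(* iota_* (D_{Theta(0)^* } xi) = (I - Theta(z) Theta(0)^* ) xi *)
Definition iotaStarD (A : nat -> 'M[C]_N) (xi : 'cV[C]_N) : H2 :=
  fun k => (if k is 0 then xi else 0) - A k *m (adj (Theta0 A) *m xi).
(* w = D_{Theta(0)} iota^* x, i.e. w = (iota D_{Theta(0)})^* x *)
Definition is_Diota_adj (A : nat -> 'M[C]_N) (x : H2) (w : 'cV[C]_N) : Prop :=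
  forall xi, h2dot (iotaD A xi) x = vdot xi w.

Definition numrange {E : Type} (ip : E -> E -> C) (V : set E)
  (T : E -> E -> Prop) : set C :=
  [set z | exists x y, V x /\ ip x x = 1 /\ T x y /\ z = ip y x].

Definition S_graph (A : nat -> 'M[C]_N) (x y : H2) : Prop :=
  is_proj (KTheta A) (shiftz x) y.
Definition W_S (A : nat -> 'M[C]_N) : set C :=
  numrange h2dot (KTheta A) (S_graph A).

Definition sum_ip (p q : H2 * 'cV[C]_N) : C := h2dot p.1 q.1 + vdot p.2 q.2.
Definition U_graph (A : nat -> 'M[C]_N) (Om : 'M[C]_N)
  (p q : H2 * 'cV[C]_N) : Prop :=
  exists Sx w, S_graph A p.1 Sx /\ is_Diota_adj A p.1 w /\
    q.1 = h2add Sx (iotaStarD A (Om *m p.2)) /\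
    q.2 = w + adj (Theta0 A) *m (Om *m p.2).
Definition W_U (A : nat -> 'M[C]_N) (Om : 'M[C]_N) : set C :=
  numrange sum_ip [set p | KTheta A p.1] (U_graph A Om).

(* Hausdorff distance between S and T is at most eps (squared-modulus scale) *)
Definition hausdorff_close (S T : set C) (eps : R) : Prop :=
  (forall s, S s -> exists t, T t /\ cabs2 (s - t) < eps) /\
  (forall t, T t -> exists s, S s /\ cabs2 (s - t) < eps).

Definition in_Kfrak (S : set C) : Prop :=
  (exists z, S z) /\ cbounded S /\ cclosure S `<=` S.

Definition wraps (tau : 'M[C]_N -> set C) (K0 : set C) : Prop :=
  (forall Om, unitary_mx Om -> in_Kfrak (tau Om)) /\
  (forall Om, unitary_mx Om -> forall eps : R, 0 < eps ->
     exists delta : R, 0 < delta /\ forall Om', unitary_mx Om' ->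
       (forall i j, cabs2 (Om i j - Om' i j) < delta) ->
       hausdorff_close (tau Om) (tau Om') eps) /\
  (forall Hp, open_halfplane Hp -> K0 `<=` Hp ->
     exists Om, unitary_mx Om /\ tau Om `<=` Hp).

End ModelSpaces.

(* Main.v *)
(* Let the half-plane be [L z > c] with [L z = re (cconj a * z)]; compactness
   gives [m > c] with [L >= m] on W(S_Theta).  Choose [zeta] on the unit circle
   with [c < L zeta < m]; this is possible unless [c < - |a|], when any unitary
   will do.  Then [S_Theta - zeta] is coercive on K_Theta, so for
   every [y] there is [f] in K_Theta with (f, y) sent to (zeta f, E y) by the
   dilation with parameter 1; that dilation is isometric, so E is unitary, and
   [Om = zeta E^*] makes [zeta] an eigenvalue of U_Om whose eigenvectors
   e = (F x, x) have arbitrary second component.  Writing a vector v of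
   K_Theta + C^N as v = e + k with e such an eigenvector and k in K_Theta,
   and using that U_Om is isometric,
     L <U_Om v, v> = (L zeta) |v|^2 + L <S_Theta k, k> - (L zeta) |k|^2
                  >= (L zeta) |v|^2.
   So W(U_Om) lies in [L >= L zeta].  That Theta acts isometrically on H^2
   is Parseval's identity on the circles |z| = r, with r tending to 1 by
   dominated convergence. *)
From mathcomp Require Import all_boot all_order all_algebra.
From mathcomp Require Import all_classical all_reals all_analysis.
From mathcomp Require Import complex ring lra.
(* Last, because mathcomp-analysis also declares [mulTheta] and [cscale]. *)
Require Import Defs.

Set Implicit Arguments.
Unset Strict Implicit.
Unset Printing Implicit Defensive.
Import Order.TTheory GRing.Theory Num.Theory numFieldNormedType.Exports.
Local Open Scope ring_scope.
Local Open Scope classical_set_scope.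

(** A half-plane sees only [L <u, v> = Re <u, a v>], so the argument runs on the real form [rd] with
    complex scalars; imaginary parts return by pairing with [i v]. No abstract projection onto
    K_Theta is needed: for f in K_Theta, x + z f is already orthogonal to z Theta H^2, so only its
    component along Theta C^N has to be removed. This finite-rank correction [mproj], together with
    the removed coordinate [top], yields all four blocks of the dilation, and Pythagoras for it is
    the isometry of the dilation. The point [zeta] must lie on the circle, being an eigenvalue of a
    unitary. Since S_Theta is a contraction and K_Theta is nonzero (here purity enters), m <= |a|;
    with c >= -|a| the midpoint r = (c + m) / 2 has |r| <= |a|, so the line L = r meets the circle.
    The gap m - r is then a coercivity constant, and S_Theta - zeta is inverted by an explicit
    contracting iteration instead of spectral theory. *)

Section ComplexNumbers.
Context (R : realType).
Local Notation C := (complex R).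
Implicit Types (x y z : C).

Lemma complexP x y : re x = re y -> im x = im y -> x = y.
Proof. by case: x y => [a b] [c d] /= -> ->. Qed.

Lemma reD x y : re (x + y) = re x + re y. Proof. by case: x y => [a b] [c d]. Qed.
Lemma imD x y : im (x + y) = im x + im y. Proof. by case: x y => [a b] [c d]. Qed.
Lemma reN x : re (- x) = - re x. Proof. by case: x. Qed.
Lemma imN x : im (- x) = - im x. Proof. by case: x. Qed.
Lemma reM x y : re (x * y) = re x * re y - im x * im y.
Proof. by case: x y => [a b] [c d]. Qed.
Lemma imM x y : im (x * y) = re x * im y + im x * re y.
Proof. by case: x y => [a b] [c d]. Qed.
Lemma re0 : re (0 : C) = 0. Proof. by []. Qed.
Lemma im0 : im (0 : C) = 0. Proof. by []. Qed.
Lemma re1 : re (1 : C) = 1. Proof. by []. Qed.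
Lemma im1 : im (1 : C) = 0. Proof. by []. Qed.
Lemma re_conj x : re (cconj x) = re x. Proof. by []. Qed.
Lemma im_conj x : im (cconj x) = - im x. Proof. by []. Qed.
Definition ReIm := (reD, imD, reN, imN, reM, imM, re0, im0, re1, im1, re_conj, im_conj).

Lemma re_sum I (r : seq I) (P : pred I) (F : I -> C) :
  re (\sum_(i <- r | P i) F i) = \sum_(i <- r | P i) re (F i).
Proof. exact: (big_morph _ reD). Qed.
Lemma im_sum I (r : seq I) (P : pred I) (F : I -> C) :
  im (\sum_(i <- r | P i) F i) = \sum_(i <- r | P i) im (F i).
Proof. exact: (big_morph _ imD). Qed.

Lemma cconjD x y : cconj (x + y) = cconj x + cconj y.
Proof. by apply: complexP; rewrite !ReIm //; ring. Qed.
Lemma cconjM x y : cconj (x * y) = cconj x * cconj y.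
Proof. by apply: complexP; rewrite !ReIm; ring. Qed.
Lemma cconjK x : cconj (cconj x) = x.
Proof. by apply: complexP; rewrite !ReIm //; ring. Qed.
Lemma cconj0 : cconj (0 : C) = 0.
Proof. by apply: complexP; rewrite !ReIm //; ring. Qed.
Lemma cconj1 : cconj (1 : C) = 1.
Proof. by apply: complexP; rewrite !ReIm //; ring. Qed.
Lemma cconj_sum I (r : seq I) (P : pred I) (F : I -> C) :
  cconj (\sum_(i <- r | P i) F i) = \sum_(i <- r | P i) cconj (F i).
Proof. exact: (big_morph _ cconjD cconj0). Qed.

Lemma cabs2_ge0 x : 0 <= cabs2 x.
Proof. by rewrite addr_ge0 ?sqr_ge0. Qed.
Lemma cabs2M x y : cabs2 (x * y) = cabs2 x * cabs2 y.
Proof. by rewrite /cabs2 !ReIm; ring. Qed.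
Lemma cabs2N x : cabs2 (- x) = cabs2 x.
Proof. by rewrite /cabs2 !ReIm; ring. Qed.
Lemma cabs2_conj x : cabs2 (cconj x) = cabs2 x.
Proof. by rewrite /cabs2 !ReIm; ring. Qed.
Lemma cabs20 : cabs2 (0 : C) = 0.
Proof. by rewrite /cabs2 !ReIm; ring. Qed.
Lemma cabs21 : cabs2 (1 : C) = 1.
Proof. by rewrite /cabs2 !ReIm; ring. Qed.
Lemma cabs2X x n : cabs2 (x ^+ n) = cabs2 x ^+ n.
Proof. by elim: n => [|n IH]; rewrite ?expr0 ?cabs21 // !exprS cabs2M IH. Qed.
Lemma mulcconj x : cconj x * x = Complex (cabs2 x) 0.
Proof. by apply: complexP; rewrite !ReIm /cabs2 //=; ring. Qed.
Lemma cabs2_eq0 x : (cabs2 x == 0) = (x == 0).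
Proof.
apply/eqP/eqP => [|->]; last exact: cabs20.
rewrite /cabs2 => h; apply: complexP; rewrite !ReIm; nra.
Qed.
Lemma cabs2_gt0 x : (0 < cabs2 x) = (x != 0).
Proof. by rewrite lt_neqAle cabs2_ge0 andbT eq_sym cabs2_eq0. Qed.
Lemma cabs2D_le x y : cabs2 (x + y) <= 2 * cabs2 x + 2 * cabs2 y.
Proof.
rewrite /cabs2 !ReIm.
have := sqr_ge0 (re x - re y); have := sqr_ge0 (im x - im y); nra.
Qed.
Lemma sqr_re_le x : re x ^+ 2 <= cabs2 x.
Proof. by rewrite /cabs2 lerDl sqr_ge0. Qed.
Lemma sqr_im_le x : im x ^+ 2 <= cabs2 x.
Proof. by rewrite /cabs2 lerDr sqr_ge0. Qed.
Lemma re_conjM_le x y : `|re (cconj x * y)| <= Num.sqrt (cabs2 x * cabs2 y).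
Proof.
rewrite -sqrtr_sqr ler_sqrt; last by rewrite mulr_ge0 ?cabs2_ge0.
by rewrite -[cabs2 x]cabs2_conj -cabs2M sqr_re_le.
Qed.

Lemma cclosure_sub (S : set C) : S `<=` cclosure S.
Proof. by move=> z Sz e e0; exists z; rewrite subrr cabs20. Qed.

Lemma cclosureK (S : set C) : cclosure (cclosure S) `<=` cclosure S.
Proof.
(* [cabs2] is a squared modulus, so the triangle inequality costs a factor 2; two steps below
   [e / 4] stay below [e]. *)
move=> z Sz e e0; have e4 : 0 < e / 4 by lra.
have [s [/(_ _ e4)[t [St ts]] sz]] := Sz _ e4.
exists t; split=> //; rewrite -[z - t](subrKA s).
by apply: le_lt_trans (cabs2D_le _ _) _; lra.
Qed.

End ComplexNumbers.

(** * The Hermitian and the real inner product on C^N *)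

Section Vectors.
Context (R : realType) (N : nat).
Local Notation C := (complex R).
Implicit Types (u v w x y : 'cV[C]_N) (c : C) (M : 'M[C]_N).

Definition rv u v : R := re (vdot u v).

Lemma vdotDl u v w : vdot (u + v) w = vdot u w + vdot v w.
Proof. by rewrite /vdot -big_split; apply: eq_bigr => i _; rewrite mxE mulrDl. Qed.
Lemma vdotZl c u v : vdot (c *: u) v = c * vdot u v.
Proof. by rewrite /vdot mulr_sumr; apply: eq_bigr => i _; rewrite mxE mulrA. Qed.
Lemma vdotC u v : vdot v u = cconj (vdot u v).
Proof.
by rewrite /vdot cconj_sum; apply: eq_bigr => i _; rewrite cconjM cconjK mulrC.
Qed.
Lemma vdotZr c u v : vdot u (c *: v) = cconj c * vdot u v.
Proof. by rewrite vdotC vdotZl cconjM -vdotC. Qed.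
Lemma vdot0l v : vdot 0 v = 0.
Proof. by rewrite /vdot big1 // => i _; rewrite mxE mul0r. Qed.
Lemma vdot_mulmx M u v : vdot (M *m u) v = vdot u (adj M *m v).
Proof.
rewrite /vdot; under eq_bigr do rewrite mxE mulr_suml.
rewrite exchange_big; apply: eq_bigr => j _.
rewrite mxE cconj_sum mulr_sumr; apply: eq_bigr => i _.
by rewrite mxE cconjM cconjK; ring.
Qed.
Lemma adjK M : adj (adj M) = M.
Proof. by apply/matrixP => i j; rewrite !mxE cconjK. Qed.

Lemma rvDl u v w : rv (u + v) w = rv u w + rv v w.
Proof. by rewrite /rv vdotDl reD. Qed.
Lemma rvC u v : rv u v = rv v u.
Proof. by rewrite /rv vdotC re_conj. Qed.
Lemma rvDr u v w : rv w (u + v) = rv w u + rv w v.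
Proof. by rewrite rvC rvDl !(rvC w). Qed.
Lemma rv0l v : rv 0 v = 0. Proof. by rewrite /rv vdot0l. Qed.
Lemma rvZ c u v : rv (c *: u) v = rv u (cconj c *: v).
Proof. by rewrite /rv vdotZl vdotZr cconjK. Qed.
Lemma vdotE u v : vdot u v = Complex (rv u v) (rv u ('i%C *: v)).
Proof.
by apply: complexP => //=; rewrite /rv vdotZr reM !ReIm /=; ring.
Qed.
Lemma vnorm2E u : vnorm2 u = rv u u.
Proof.
rewrite /rv /vdot re_sum; apply: eq_bigr => i _.
by rewrite /cabs2 !ReIm; ring.
Qed.
Lemma vnorm2_ge0 u : 0 <= vnorm2 u.
Proof. by apply: sumr_ge0 => i _; exact: cabs2_ge0. Qed.
Lemma vnorm2Z c u : vnorm2 (c *: u) = cabs2 c * vnorm2 u.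
Proof. by rewrite /vnorm2 mulr_sumr; apply: eq_bigr => i _; rewrite mxE cabs2M. Qed.
Lemma vnorm20 : vnorm2 (0 : 'cV[C]_N) = 0.
Proof. by rewrite vnorm2E rv0l. Qed.
Lemma vnorm2_eq0 u : vnorm2 u = 0 -> u = 0.
Proof.
move=> /eqP; rewrite psumr_eq0 => [/allP h|i _]; last exact: cabs2_ge0.
apply/colP => i; rewrite mxE; apply/eqP.
by rewrite -cabs2_eq0; apply: h; rewrite mem_index_enum.
Qed.
Lemma vnorm2N u : vnorm2 (- u) = vnorm2 u.
Proof. by rewrite /vnorm2; apply: eq_bigr => i _; rewrite mxE cabs2N. Qed.
Lemma vnorm2D u v : vnorm2 (u + v) = vnorm2 u + 2 * rv u v + vnorm2 v.
Proof. by rewrite !vnorm2E rvDl !rvDr (rvC v u); ring. Qed.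
Lemma vnorm2D_le u v : vnorm2 (u + v) <= 2 * vnorm2 u + 2 * vnorm2 v.
Proof.
rewrite /vnorm2 !mulr_sumr -big_split; apply: ler_sum => i _.
by rewrite mxE cabs2D_le.
Qed.
Lemma rvN u v : rv u (- v) = - rv u v.
Proof.
by apply/eqP; rewrite -addr_eq0 -rvDr addNr rvC rv0l.
Qed.
(** Both |u + v|^2 and |u - v|^2 are nonnegative. A sum on the right dominates the series of
    [rv (f k) (g k)] termwise by a convergent one. *)
Lemma rv_le u v : `|rv u v| <= vnorm2 u + vnorm2 v.
Proof.
have := vnorm2_ge0 (u + v); have := vnorm2_ge0 (u - v).
have := vnorm2_ge0 u; have := vnorm2_ge0 v.
by rewrite !vnorm2D vnorm2N rvN ler_norml => *; lra.
Qed.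

Lemma rv_inj x y : (forall w, rv x w = rv y w) -> x = y.
Proof.
move=> h; apply/eqP; rewrite -subr_eq0; apply/eqP/vnorm2_eq0.
rewrite vnorm2E rvDl h -rvDl.
by rewrite (rvC (_ + _)) -[- y]scaleN1r rvC; rewrite scaleN1r subrr rv0l.
Qed.

Lemma mulmx_id M : (forall x, M *m x = x) -> M = 1%:M.
Proof.
move=> h; apply/matrixP => i j.
by have := h (delta_mx j 0); rewrite -colE => /colP/(_ i); rewrite !mxE andbT.
Qed.

Lemma adjZ c M : adj (c *: M) = cconj c *: adj M.
Proof. by apply/matrixP => i j; rewrite !mxE cconjM. Qed.

Lemma vnorm2_isometry (B : 'M[C]_N) x : isometry_mx B -> vnorm2 (B *m x) = vnorm2 x.
Proof.
by move=> iB; rewrite !vnorm2E /rv vdot_mulmx mulmxA iB mul1mx.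
Qed.

End Vectors.

(** * Series and the Hardy space H^2(C^N) *)

Section RealSeries.
Context (R : realType).
Implicit Types (u v : nat -> R).

Lemma series_nondecreasing u : (forall k, 0 <= u k) ->
  {homo series u : n m / (n <= m)%N >-> n <= m}.
Proof.
by move=> u0; apply/nondecreasing_seqP => n; rewrite /series /= big_nat_recr //= lerDl.
Qed.

Lemma series_bounded_cvg u M : (forall k, 0 <= u k) ->
  (forall n, \sum_(k < n) u k <= M) ->
  cvgn (series u) /\ limn (series u) <= M.
Proof.
move=> u0 uM; have cu : cvgn (series u).
  apply: nondecreasing_is_cvgn; first exact: series_nondecreasing.
  by exists M => _ [n _ <-]; rewrite /series /= big_mkord.
by split => //; apply: limr_le => //; apply: nearW => n; rewrite /series /= big_mkord.
Qed.

Lemma series_partial_le u n : (forall k, 0 <= u k) -> cvgn (series u) ->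
  \sum_(k < n) u k <= limn (series u).
Proof.
move=> u0 cu; have := nondecreasing_cvgn_le (series_nondecreasing u0) cu n.
by rewrite /series /= big_mkord.
Qed.

Lemma series_abs_cvg u v : (forall k, `|u k| <= v k) -> cvgn (series v) ->
  cvgn (series u).
Proof.
move=> uv cv; apply: (@normed_cvg R R^o).
apply: series_le_cvg cv => // k; first exact: normr_ge0.
by apply: le_trans (uv k).
Qed.

Lemma series_finsupp u n : (forall k, (n <= k)%N -> u k = 0) ->
  series u @ \oo --> \sum_(k < n) u k.
Proof.
move=> u0; apply: cvg_near_cst; near=> m.
have nm : (n <= m)%N by near: m; exists n.
rewrite /series /= (@big_cat_nat _ _ _ n 0%N m) //= [X in _ + X = _]big_nat_cond [X in _ + X = _]big1 ?addr0 ?big_mkord //.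
by move=> i /andP[/andP[/u0 ->]].
Unshelve. all: by end_near. Qed.

Lemma series_cons u : cvgn (series (fun k => u k.+1)) ->
  series u @ \oo --> u 0%N + limn (series (fun k => u k.+1)).
Proof.
move=> cu; rewrite -(cvg_shiftn 1%N) /=.
have -> : (fun n => series u (n + 1)%N) = (fun n => u 0%N + series (fun k => u k.+1) n).
  by apply/funext => n; rewrite /series /= addn1 big_nat_recl.
by apply: cvgD; [exact: cvg_cst | exact: cu].
Qed.

Lemma le_epsilon_lin (x M : R) :
  0 <= M -> (forall e, 0 < e -> x <= M * e) -> x <= 0.
Proof.
move=> M0 h; case: (leP x 0) => // x0.
have e0 : 0 < x / (2 * (M + 1)) by apply: divr_gt0 => //; lra.
have := h _ e0; rewrite mulrA ler_pdivlMr; last lra.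
nra.
Qed.

End RealSeries.

Section HardySpace.
Context (R : realType) (N : nat).
Local Notation C := (complex R).
Local Notation seqs := (nat -> 'cV[C]_N).
Implicit Types (f g h : seqs) (c : C) (x y : 'cV[C]_N).

Definition rd f g : R := limn (series (fun k => rv (f k) (g k))).

Lemma rv_sum_cvg f g : in_H2 f -> in_H2 g -> cvgn (series (fun k => rv (f k) (g k))).
Proof.
move=> Hf Hg; apply: (@series_abs_cvg _ _ (fun k => vnorm2 (f k) + vnorm2 (g k))).
  by move=> k; exact: rv_le.
exact: (@is_cvg_seriesD _ (fun k => vnorm2 (f k) : R^o)).
Qed.

Lemma rdE f : rd f f = limn (series (fun k => vnorm2 (f k))).
Proof. by congr (limn (series _)); apply/funext => k; rewrite vnorm2E. Qed.

Lemma H2_bounded f M : (forall n, \sum_(k < n) vnorm2 (f k) <= M) ->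
  in_H2 f /\ rd f f <= M.
Proof. by rewrite rdE; apply: series_bounded_cvg => k; exact: vnorm2_ge0. Qed.

Lemma rd_partial f n : in_H2 f -> \sum_(k < n) vnorm2 (f k) <= rd f f.
Proof. by rewrite rdE; apply: series_partial_le => k; exact: vnorm2_ge0. Qed.

Lemma rd_ge0 f : in_H2 f -> 0 <= rd f f.
Proof. by move/(rd_partial 0%N); rewrite big_ord0. Qed.

Lemma vnorm2_coef_le f k : in_H2 f -> vnorm2 (f k) <= rd f f.
Proof.
move/(rd_partial k.+1); apply: le_trans; rewrite big_ord_recr /= lerDr.
by apply: sumr_ge0 => i _; exact: vnorm2_ge0.
Qed.

Lemma rd_eq0 f : in_H2 f -> rd f f = 0 -> f = 0.
Proof.
move=> Hf f0; apply/funext => k; apply: vnorm2_eq0; apply/le_anti.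
by rewrite vnorm2_ge0 -f0 vnorm2_coef_le.
Qed.

Lemma in_H2D f g : in_H2 f -> in_H2 g -> in_H2 (f + g).
Proof.
move=> Hf Hg.
apply: (proj1 (@H2_bounded (f + g) (2 * rd f f + 2 * rd g g) _)) => n.
apply: (@le_trans _ _ (\sum_(k < n) (2 * vnorm2 (f k) + 2 * vnorm2 (g k)))).
  by apply: ler_sum => k _; exact: vnorm2D_le.
by rewrite big_split /= -!mulr_sumr lerD // ler_pM2l // rd_partial.
Qed.

Lemma in_H2Z c f : in_H2 f -> in_H2 (c *: f).
Proof.
move=> Hf; apply: (proj1 (@H2_bounded (c *: f) (cabs2 c * rd f f) _)) => n.
under eq_bigr do rewrite vnorm2Z.
by rewrite -mulr_sumr ler_wpM2l ?cabs2_ge0 ?rd_partial.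
Qed.
Arguments in_H2Z c [f] _.

Lemma in_H2N f : in_H2 f -> in_H2 (- f).
Proof. by rewrite -scaleN1r; exact: in_H2Z. Qed.

Lemma in_H2B f g : in_H2 f -> in_H2 g -> in_H2 (f - g).
Proof. by move=> Hf /in_H2N; exact: in_H2D. Qed.

Lemma in_H20 : in_H2 (0 : seqs).
Proof.
apply: (proj1 (@H2_bounded (0 : seqs) 0 _)) => n.
by rewrite big1 // => i _; rewrite vnorm20.
Qed.

Lemma rdC f g : rd f g = rd g f.
Proof. by congr (limn (series _)); apply/funext => k; rewrite rvC. Qed.

Lemma rdZl c f g : rd (c *: f) g = rd f (cconj c *: g).
Proof. by congr (limn (series _)); apply/funext => k; rewrite rvZ. Qed.

Lemma rdZr c f g : rd f (c *: g) = rd (cconj c *: f) g.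
Proof. by rewrite rdZl cconjK. Qed.

Lemma rdDl f g h : in_H2 f -> in_H2 g -> in_H2 h ->
  rd (f + g) h = rd f h + rd g h.
Proof.
move=> Hf Hg Hh; rewrite /rd -(@lim_seriesD R^o); [|exact: rv_sum_cvg..].
by congr (limn (series _)); apply/funext => k; exact: rvDl.
Qed.

Lemma rdDr f g h : in_H2 f -> in_H2 g -> in_H2 h ->
  rd h (f + g) = rd h f + rd h g.
Proof. by move=> *; rewrite rdC rdDl // !(rdC h). Qed.

Lemma rd0l g : rd 0 g = 0.
Proof.
rewrite /rd; have -> : (fun k => rv ((0 : seqs) k) (g k)) = fun=> 0.
  by apply/funext => k; exact: rv0l.
by apply: cvg_lim => //; have := @series_finsupp R (fun=> 0) 0%N (fun _ _ => erefl); rewrite big_ord0.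
Qed.
Lemma rd0r g : rd g 0 = 0. Proof. by rewrite rdC rd0l. Qed.

Lemma rdNl f g : in_H2 f -> in_H2 g -> rd (- f) g = - rd f g.
Proof.
move=> Hf Hg; apply/eqP; rewrite -addr_eq0 -rdDl ?addNr ?rd0l //; exact: in_H2N.
Qed.

Lemma rdBl f g h : in_H2 f -> in_H2 g -> in_H2 h ->
  rd (f - g) h = rd f h - rd g h.
Proof. by move=> Hf Hg Hh; rewrite rdDl ?rdNl //; exact: in_H2N. Qed.
Lemma rdBr f g h : in_H2 f -> in_H2 g -> in_H2 h ->
  rd h (f - g) = rd h f - rd h g.
Proof. by move=> Hf Hg Hh; rewrite rdC rdBl // !(rdC h). Qed.

Lemma scale_complex0 (r : R) x : rv (Complex r 0 *: x) = (fun y => r * rv x y).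
Proof. by apply/funext => y; rewrite /rv vdotZl reM /= mul0r subr0. Qed.

Lemma rdZreal (r : R) f g : in_H2 f -> in_H2 g ->
  rd (Complex r 0 *: f) g = r * rd f g.
Proof.
move=> Hf Hg; rewrite -[RHS](@lim_seriesZ R^o _ r (rv_sum_cvg Hf Hg)).
by congr (limn (series _)); apply/funext => k; rewrite scale_complex0.
Qed.

Lemma rdZZ c f g : in_H2 f -> in_H2 g -> rd (c *: f) (c *: g) = cabs2 c * rd f g.
Proof.
move=> Hf Hg; rewrite rdZl scalerA mulcconj rdC rdZreal // rdC //.
Qed.

Lemma rdD_sqr f g : in_H2 f -> in_H2 g ->
  rd (f + g) (f + g) = rd f f + 2 * rd f g + rd g g.
Proof.
move=> Hf Hg; have Hfg := in_H2D Hf Hg.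
by rewrite rdDl // !rdDr // (rdC g f); ring.
Qed.
Lemma rdB_sqr f g : in_H2 f -> in_H2 g ->
  rd (f - g) (f - g) = rd f f - 2 * rd f g + rd g g.
Proof.
move=> Hf Hg; have Hfg := in_H2B Hf Hg.
by rewrite rdBl // !rdBr // (rdC g f); ring.
Qed.
Lemma rdD_le f g : in_H2 f -> in_H2 g ->
  rd (f + g) (f + g) <= 2 * rd f f + 2 * rd g g.
Proof.
move=> Hf Hg; have := rd_ge0 (in_H2B Hf Hg); rewrite rdB_sqr // rdD_sqr //; lra.
Qed.
Lemma rdB_le f g : in_H2 f -> in_H2 g ->
  rd (f - g) (f - g) <= 2 * rd f f + 2 * rd g g.
Proof.
move=> Hf Hg; have := rd_ge0 (in_H2D Hf Hg); rewrite rdB_sqr // rdD_sqr //; lra.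
Qed.

Lemma rd_CS f g : in_H2 f -> in_H2 g -> rd f g ^+ 2 <= rd f f * rd g g.
Proof.
move=> Hf Hg.
have f0 := rd_ge0 Hf; have g0 := rd_ge0 Hg.
have key (r : R) : 0 <= r ^+ 2 * rd f f - 2 * r * rd f g + rd g g.
  have Hrf := in_H2Z (Complex r 0) Hf.
  have := rd_ge0 (in_H2B Hrf Hg); rewrite rdB_sqr // rdZZ // rdZreal //.
  by rewrite /cabs2 /=; congr (0 <= _); ring.
have [fz|fnz] := eqVneq (rd f f) 0.
  rewrite fz in key *; rewrite mul0r.
  have [-> |fg0] := eqVneq (rd f g) 0; first by rewrite expr0n.
  (* When |f| = 0 the quadratic in [r] is affine, and at this [r] it equals -|g|^2 - 2 < 0. *)
  have := key ((rd g g + 1) / rd f g).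
  have -> : 2 * ((rd g g + 1) / rd f g) * rd f g = 2 * (rd g g + 1) by field.
  by rewrite mulr0 => ?; lra.
have fp : 0 < rd f f by rewrite lt_neqAle eq_sym fnz.
have := key (rd f g / rd f f).
have -> : (rd f g / rd f f) ^+ 2 * rd f f - 2 * (rd f g / rd f f) * rd f g + rd g g
  = rd g g - rd f g ^+ 2 / rd f f by field.
by rewrite subr_ge0 ler_pdivrMr // mulrC.
Qed.

Lemma h2dotE f g : h2dot f g = Complex (rd f g) (rd f ('i%C *: g)).
Proof.
by congr Complex; congr (limn (series _)); apply/funext => k; rewrite vdotE.
Qed.

Lemma h2dot_re_conj c f g : in_H2 f -> in_H2 g ->
  re (cconj c * h2dot f g) = rd f (c *: g).
Proof.
move=> Hf Hg; have -> : c = Complex (re c) 0 + Complex (im c) 0 * 'i%C.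
  by apply: complexP; rewrite !ReIm /=; ring.
have Hig := in_H2Z 'i%C Hg.
rewrite scalerDl -scalerA rdDr; [|exact: in_H2Z|exact: in_H2Z|exact: Hf].
rewrite !(rdC f) !rdZreal // h2dotE !ReIm /= !(rdC f); ring.
Qed.

(** Scaling [g] by the number <f, g> makes the pairing real: with t = |<f, g>|^2, the real
    inequality reads t^2 <= t |f|^2 |g|^2. *)
Lemma h2dot_CS f g : in_H2 f -> in_H2 g -> cabs2 (h2dot f g) <= rd f f * rd g g.
Proof.
move=> Hf Hg; have := rd_CS Hf (in_H2Z (h2dot f g) Hg).
rewrite -h2dot_re_conj // mulcconj /= rdZZ //.
have f0 := rd_ge0 Hf; have g0 := rd_ge0 Hg.
have := cabs2_ge0 (h2dot f g); move: (cabs2 _) => t t0.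
have := mulr_ge0 f0 g0; rewrite mulrCA; move: (rd f f * rd g g) => m m0 h.
by case: (leP t m) => // mt; nra.
Qed.

Lemma h2dot_self f : in_H2 f -> h2dot f f = Complex (rd f f) 0.
Proof.
move=> Hf; have Hif := in_H2Z 'i%C Hf; rewrite h2dotE; congr Complex.
have := rdZr 'i%C f f; have -> : cconj 'i%C = - 'i%C :> C.
  by apply: complexP; rewrite !ReIm //=; ring.
rewrite scaleNr rdNl // (rdC _ f); lra.
Qed.

Lemma h2dot_norm1 f : in_H2 f -> (h2dot f f = 1 <-> rd f f = 1).
Proof. by move=> /h2dot_self ->; split => [[]|->]. Qed.

Lemma rdZZ_self (z w : C) f : in_H2 f -> rd (z *: f) (w *: f) = re (cconj w * z) * rd f f.
Proof.
move=> Hf; rewrite rdZl scalerA -h2dot_re_conj // h2dot_self //.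
by rewrite cconjM cconjK !ReIm /=; ring.
Qed.

Lemma rd_sumr g (I : Type) (s : seq I) (F : I -> seqs) : in_H2 g ->
  (forall i, in_H2 (F i)) ->
  in_H2 (\sum_(i <- s) F i) /\ rd g (\sum_(i <- s) F i) = \sum_(i <- s) rd g (F i).
Proof.
move=> Hg HF; elim: s => [|i s [IH1 IH2]].
  by rewrite !big_nil rd0r; split => //; exact: in_H20.
by rewrite !big_cons rdDr // IH2; split => //; exact: in_H2D.
Qed.

(** The Taylor coefficients of x + z f(z). *)
Definition hcons x f : seqs := fun k => if k is k'.+1 then f k' else x.
Definition hcst x : seqs := hcons x 0.

Lemma in_H2_hcons x f : in_H2 f -> in_H2 (hcons x f).
Proof. by move=> Hf; apply/cvg_ex; eexists; exact: (@series_cons _ (fun k => vnorm2 (hcons x f k))). Qed.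
Lemma in_H2_behead f : in_H2 f -> in_H2 (fun k => f k.+1).
Proof.
move=> Hf; apply: (proj1 (@H2_bounded (fun k => f k.+1) (rd f f) _)) => n.
apply: le_trans (rd_partial n.+1 Hf); rewrite big_ord_recl /= lerDr; exact: vnorm2_ge0.
Qed.
Lemma in_H2_hcst x : in_H2 (hcst x).
Proof. exact/in_H2_hcons/in_H20. Qed.
Lemma hcons_behead f : hcons (f 0%N) (fun k => f k.+1) = f.
Proof. by apply/funext => -[]. Qed.
Lemma rd_hcons x y f g : in_H2 f -> in_H2 g ->
  rd (hcons x f) (hcons y g) = rv x y + rd f g.
Proof.
move=> Hf Hg; apply: cvg_lim => //.
exact/(@series_cons _ (fun k => rv (hcons x f k) (hcons y g k)))/rv_sum_cvg.
Qed.
Lemma hconsD x y f g : hcons x f + hcons y g = hcons (x + y) (f + g).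
Proof. by apply/funext => -[]. Qed.
Lemma hconsZ c x f : c *: hcons x f = hcons (c *: x) (c *: f).
Proof. by apply/funext => -[]. Qed.
Lemma shiftzE f : shiftz f = hcons 0 f.
Proof. by apply/funext => -[]. Qed.

Definition trunc n f : seqs := fun k => if (k < n)%N then f k else 0.

Lemma in_H2_finsupp f n : (forall k, (n <= k)%N -> f k = 0) ->
  in_H2 f /\ rd f f = \sum_(k < n) vnorm2 (f k).
Proof.
move=> f0.
have h := @series_finsupp _ (fun k => vnorm2 (f k)) n.
have {}h : series (fun k => vnorm2 (f k)) @ \oo --> \sum_(k < n) vnorm2 (f k).
  by apply: h => k /f0 ->; rewrite vnorm20.
by split; [apply/cvg_ex; eexists; exact: h | rewrite rdE; exact: cvg_lim].
Qed.

Lemma trunc_cvg f e : in_H2 f -> 0 < e ->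
  exists n, rd (f - trunc n f) (f - trunc n f) < e.
Proof.
move=> Hf e0; have /cvgrPdist_lt/(_ _ e0)[n _ /(_ n (leqnn n))] := Hf.
rewrite -rdE /series /= big_mkord => h; exists n.
have [Ht tE] : in_H2 (trunc n f) /\ rd (trunc n f) (trunc n f) = \sum_(k < n) vnorm2 (trunc n f k).
  by apply: in_H2_finsupp => k; rewrite /trunc ltnNge => ->.
have tE' : rd (trunc n f) (trunc n f) = \sum_(k < n) vnorm2 (f k).
  by rewrite tE; apply: eq_bigr => k _; rewrite /trunc ltn_ord.
have fE : rd f (trunc n f) = rd (trunc n f) (trunc n f).
  congr (limn (series _)); apply/funext => k; rewrite /trunc.
  by case: ifP => // _; rewrite rvC !rv0l.
rewrite rdB_sqr // fE tE'; apply: le_lt_trans h; apply: le_trans (ler_norm _).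
by rewrite le_eqVlt; apply/orP; left; apply/eqP; ring.
Qed.

End HardySpace.

Arguments in_H2_hcons {R N} x [f] _.
Arguments in_H2_hcst {R N} x.
Arguments in_H2Z {R N} c [f] _.

Lemma h2dotBl (R : realType) (N : nat) (f g h : nat -> 'cV[complex R]_N) :
  in_H2 f -> in_H2 g -> in_H2 h -> h2dot (f - g) h = h2dot f h - h2dot g h.
Proof.
move=> Hf Hg Hh; have Hih := in_H2Z 'i%C Hh.
rewrite !h2dotE (rdBl Hf Hg Hh) (rdBl Hf Hg Hih).
by apply: complexP; rewrite !ReIm.
Qed.

(** One step of the relaxation scheme that later solves the resolvent equation, with [g] the image
    of [f] under S_Theta - zeta. The factor [cconj a] makes the cross term the pairing with [a *: f]
    that coercivity bounds below. *)
Lemma rd_relax (R : realType) (N : nat) (eta : R) (a : complex R)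
    (f g : nat -> 'cV[complex R]_N) : in_H2 f -> in_H2 g ->
  rd (f - (Complex eta 0 * cconj a) *: g) (f - (Complex eta 0 * cconj a) *: g) =
  rd f f - 2 * (eta * rd g (a *: f)) + eta ^+ 2 * cabs2 a * rd g g.
Proof.
move=> Hf Hg; have Hag := in_H2Z (cconj a) Hg.
rewrite (rdB_sqr Hf (in_H2Z _ Hg)) rdZZ // (rdC f) -scalerA rdZreal //.
rewrite rdZl cconjK cabs2M cabs2_conj; congr (_ + _ * _ * _).
by rewrite /cabs2 /= expr0n addr0.
Qed.

(** * Parseval's identity *)

Section RealIntegrals.
Context (R : realType).
Local Notation mu := (@lebesgue_measure R).
Implicit Types (f g F : R -> R) (a b v w : R).

(** Carrying an antiderivative along lets sums be handled without integrability conditions; the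
    fundamental theorem of calculus is applied once, at the end. *)
Definition primitive_on a b f v :=
  continuous f /\ exists2 F : R -> R, (forall x : R, is_derive x 1 F (f x)) & F b - F a = v.

Lemma primitive_onD a b f g v w : primitive_on a b f v -> primitive_on a b g w ->
  primitive_on a b (fun x => f x + g x) (v + w).
Proof.
move=> [cf [F dF <-]] [cg [G dG <-]]; split.
  by move=> x; apply: cvgD; [exact: cf | exact: cg].
exists (fun x => F x + G x); last by ring.
by move=> x; exact: is_deriveD.
Qed.

Lemma primitive_on_sum a b n (f : nat -> R -> R) (v : nat -> R) :
  (forall k, (k < n)%N -> primitive_on a b (f k) (v k)) ->
  primitive_on a b (fun x => \sum_(k < n) f k x) (\sum_(k < n) v k).
Proof.
elim: n => [|n IH] h.
  rewrite big_ord0; have -> : (fun x => \sum_(k < 0) f k x) = fun=> 0.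
    by apply/funext => x; rewrite big_ord0.
  split; first by move=> x; exact: cvg_cst.
  by exists (fun=> 0); rewrite ?subrr // => x; exact: is_derive_cst.
rewrite big_ord_recr /=; under eq_fun do rewrite big_ord_recr /=.
by apply: primitive_onD; [apply: IH => k kn; apply: h; exact: leqW | exact: h].
Qed.

Lemma primitive_on_cst a b c : primitive_on a b (fun=> c) (c * (b - a)).
Proof.
split; first by move=> x; exact: cvg_cst.
exists (fun x => c * x); last by ring.
by move=> x; have := @is_deriveZ R _ _ id c x 1 1 (is_derive_id x 1); rewrite scaler1.
Qed.

Lemma is_derive_dilate (m x : R) : is_derive x 1 (fun t : R => m * t) m.
Proof.
have := @is_deriveZ R _ _ id m x 1 1 (is_derive_id x 1).
by rewrite [m *: 1]mulr1.
Qed.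

Lemma primitive_on_trig p q m : (0 < m)%N ->
  primitive_on 0 (2 * pi) (fun t => p * cos (m%:R * t) + q * sin (m%:R * t)) 0.
Proof.
move=> m0; have mN0 : m%:R != 0 :> R by rewrite pnatr_eq0 -lt0n.
have dS (x : R) : is_derive x 1 (fun t : R => sin (m%:R * t)) (cos (m%:R * x) * m%:R).
  exact: (is_derive1_comp (is_derive_sin _) (is_derive_dilate _ _)).
have dC (x : R) : is_derive x 1 (fun t : R => cos (m%:R * t)) (- sin (m%:R * x) * m%:R).
  exact: (is_derive1_comp (is_derive_cos _) (is_derive_dilate _ _)).
split.
  move=> x; apply: cvgD; apply: cvgMr.
    by apply: differentiable_continuous; apply/derivable1_diffP; exact: (@ex_derive _ _ _ _ _ _ _ (dC x)).
  by apply: differentiable_continuous; apply/derivable1_diffP; exact: (@ex_derive _ _ _ _ _ _ _ (dS x)).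
exists (fun t => (p / m%:R) * sin (m%:R * t) + (- q / m%:R) * cos (m%:R * t)).
  move=> x.
  have := is_deriveD (is_deriveZ (p / m%:R) (dS x)) (is_deriveZ (- q / m%:R) (dC x)).
  by move/is_derive_eq; apply; rewrite /GRing.scale /=; field.
have per k : cos (k%:R * (2 * pi)) = 1 :> R /\ sin (k%:R * (2 * pi)) = 0 :> R.
  elim: k => [|k [IHc IHs]]; first by rewrite mul0r cos0 sin0.
  rewrite -natr1 mulrDl mul1r cosD sinD IHc IHs.
  have -> : 2 * pi = pi + pi :> R by ring.
  by rewrite cosD sinD cospi sinpi; split; ring.
by have [-> ->] := per m; rewrite !mulr0 sin0 cos0; ring.
Qed.

Lemma primitive_integral a b f v : a < b -> primitive_on a b f v ->
  (\int[mu]_(x in `[a, b]) (f x)%:E = v%:E)%E.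
Proof.
move=> ab [cf [F dF <-]].
have cF : continuous F.
  by move=> x; apply: differentiable_continuous; apply/derivable1_diffP; exact: (@ex_derive _ _ _ _ _ _ _ (dF x)).
rewrite (@continuous_FTC2 _ f F) // ?EFinB //.
- exact: continuous_subspaceT.
- split.
  + by move=> x _; exact: (@ex_derive _ _ _ _ _ _ _ (dF x)).
  + by apply: cvg_at_right_filter; exact: cF.
  + by apply: cvg_at_left_filter; exact: cF.
- by move=> x _; rewrite derive1E; exact: (@derive_val _ _ _ _ _ _ _ (dF x)).
Qed.

(** The integrals of the [f n] enter through an arbitrary real sequence [v], so closed forms
    obtained from antiderivatives can be inserted directly. *)
Lemma bounded_convergence a b (f : nat -> R -> R) g (M : R) (E : set R) :
  (forall n, measurable_fun `[a, b] (f n)) -> measurable_fun `[a, b] g ->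
  measurable E -> mu E = 0%E ->
  (forall t, a <= t <= b -> ~ E t -> f n t @[n --> \oo] --> g t) ->
  (forall n t, a <= t <= b -> `|f n t| <= M) ->
  exists2 J, (\int[mu]_(x in `[a, b]) (g x)%:E = J%:E)%E &
    forall v : nat -> R, (forall n, \int[mu]_(x in `[a, b]) (f n x)%:E = (v n)%:E)%E ->
      v @ \oo --> J.
Proof.
move=> mf mg mE E0 fg fM.
have := @dominated_convergence _ _ R mu `[a, b] (measurable_itv _)
  (fun n => EFin \o f n) (EFin \o g) (EFin \o (fun=> M)).
case.
- by move=> n; apply/measurable_realfun.measurable_EFinP; exact: mf.
- by apply/measurable_realfun.measurable_EFinP; exact: mg.
- exists E; split => // t /=; apply: contra_notP => nEt abt.
  apply/fine_cvgP; split; first by apply: nearW => n.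
  by apply: fg => //; move: abt; rewrite in_itv.
- apply: continuous_compact_integrable; first exact: segment_compact.
  by apply: continuous_subspaceT => x; exact: cvg_cst.
- by apply: aeW => t n abt /=; rewrite lee_fin fM //; move: abt; rewrite /= in_itv.
move=> ig _ cJ; have [J JE] : exists J, (\int[mu]_(x in `[a, b]) (g x)%:E = J%:E)%E.
  have /fineK JE := @integrable_fin_num _ _ R mu `[a, b] (measurable_itv _) _ ig.
  by eexists; exact: esym JE.
exists J => // v vE; move: cJ; rewrite [X in _ --> X]JE.
rewrite [X in X @ \oo](_ : _ = fun n => (v n)%:E); last by apply/funext => n; exact: vE.
by move=> /fine_cvgP[_].
Qed.

End RealIntegrals.

Section ComplexConvergence.
Context (R : realType) (N : nat).
Local Notation C := (complex R).
Local Notation seqs := (nat -> 'cV[C]_N).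
Local Notation mu := (@lebesgue_measure R).
Implicit Types (a b : nat -> C) (u v : nat -> 'cV[C]_N) (f g : seqs).

Definition ccvg a (l : C) :=
  (fun n => re (a n)) @ \oo --> re l /\ (fun n => im (a n)) @ \oo --> im l.

Lemma ccvg_cst l : ccvg (fun=> l) l.
Proof. by split; exact: cvg_cst. Qed.

Lemma ccvgD a b l m : ccvg a l -> ccvg b m -> ccvg (fun n => a n + b n) (l + m).
Proof.
move=> [l1 l2] [m1 m2]; split; under eq_fun do rewrite !ReIm; rewrite !ReIm; exact: cvgD.
Qed.

Lemma ccvgM a b l m : ccvg a l -> ccvg b m -> ccvg (fun n => a n * b n) (l * m).
Proof.
move=> [l1 l2] [m1 m2]; split; under eq_fun do rewrite !ReIm; rewrite !ReIm.
  by apply: cvgB; exact: cvgM.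
by apply: cvgD; exact: cvgM.
Qed.

Lemma ccvg_sum n (F : 'I_n -> nat -> C) (l : 'I_n -> C) :
  (forall i, ccvg (F i) (l i)) -> ccvg (fun m => \sum_i F i m) (\sum_i l i).
Proof.
elim: n F l => [|n IH] F l Fl.
  by rewrite big_ord0; under eq_fun do rewrite big_ord0; exact: ccvg_cst.
rewrite big_ord_recr /=; under eq_fun do rewrite big_ord_recr /=.
by apply: ccvgD; [exact: IH | exact: Fl].
Qed.

Lemma ccvg_cabs2 a l : ccvg a l -> (fun n => cabs2 (a n)) @ \oo --> cabs2 l.
Proof. by move=> [l1 l2]; apply: cvgD; rewrite expr2; under eq_fun do rewrite expr2; exact: cvgM. Qed.

Lemma ccvg_shiftS a l : ccvg (fun n => a n.+1) l -> ccvg a l.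
Proof.
by move=> [l1 l2]; split; rewrite -cvg_shiftS.
Qed.

Lemma ccvg_csum a : csum_cvg a -> ccvg (fun n => \sum_(k < n) a k) (csum a).
Proof.
move=> [c1 c2]; split => /=.
  move: c1; rewrite (_ : series _ = fun n => re (\sum_(k < n) a k)) //.
  by apply/funext => n; rewrite re_sum /series /= big_mkord.
move: c2; rewrite (_ : series _ = fun n => im (\sum_(k < n) a k)) //.
by apply/funext => n; rewrite im_sum /series /= big_mkord.
Qed.

Definition vcvg u (l : 'cV[C]_N) := forall i, ccvg (fun n => u n i 0) (l i 0).

Lemma vcvgD u v l m : vcvg u l -> vcvg v m -> vcvg (fun n => u n + v n) (l + m).
Proof. by move=> ul vm i; under eq_fun do rewrite mxE; rewrite mxE; exact: ccvgD. Qed.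

Lemma vcvgZ z u l : vcvg u l -> vcvg (fun n => z *: u n) (z *: l).
Proof.
move=> ul i; under eq_fun do rewrite mxE; rewrite mxE.
by apply: ccvgM => //; exact: ccvg_cst.
Qed.

Lemma vcvg_shiftS u l : vcvg (fun n => u n.+1) l -> vcvg u l.
Proof. by move=> ul i; exact/ccvg_shiftS/ul. Qed.

Lemma vcvg_cst l : vcvg (fun=> l) l.
Proof. by move=> i; exact: ccvg_cst. Qed.

Lemma vcvg_mulmx (M : nat -> 'M[C]_N) (B : 'M[C]_N) u l :
  (forall i j, ccvg (fun n => M n i j) (B i j)) -> vcvg u l ->
  vcvg (fun n => M n *m u n) (B *m l).
Proof.
move=> MB ul i; under eq_fun do rewrite mxE; rewrite mxE.
by apply: ccvg_sum => j; exact: ccvgM.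
Qed.

Lemma vcvg_vnorm2 u l : vcvg u l -> (fun n => vnorm2 (u n)) @ \oo --> vnorm2 l.
Proof.
move=> ul; rewrite /vnorm2.
elim: (index_enum _) => [|i s IH].
  by rewrite big_nil; under eq_fun do rewrite big_nil; exact: cvg_cst.
rewrite big_cons; under eq_fun do rewrite big_cons.
by apply: cvgD => //; exact/ccvg_cabs2/ul.
Qed.

(** Abel's lemma: convergence at [rho] bounds the terms there, and at [r] they are then dominated by
    a geometric series of ratio [r / rho]. *)
Lemma power_series_abs (x : nat -> R) (r rho : R) : 0 <= r -> r < rho ->
  cvgn (series (fun k => x k * rho ^+ k)) -> cvgn (series (fun k => `|x k| * r ^+ k)).
Proof.
move=> r0 rrho cx; have rho0 : 0 < rho by exact: le_lt_trans rrho.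
have /cvg_series_cvg_0/cvgP/cvg_seq_bounded[M [_ bM]] := cx.
have {}bM : forall k, `|x k * rho ^+ k| <= M + 1.
  by move=> k; apply: (bM (M + 1)) => //; rewrite ltrDl.
apply: (@series_abs_cvg _ _ (geometric (M + 1) (r / rho))).
  move=> k; rewrite /geometric /= ger0_norm ?mulr_ge0 ?exprn_ge0 //.
  have -> : `|x k| * r ^+ k = `|x k * rho ^+ k| * (r / rho) ^+ k.
    rewrite normrM (ger0_norm (exprn_ge0 _ (ltW rho0))) -mulrA -exprMn.
    by rewrite (mulrC rho) divfK ?gt_eqF.
  by apply: ler_wpM2r => //; apply: exprn_ge0; exact: divr_ge0 (ltW _).
apply: is_cvg_geometric_series.
by rewrite ger0_norm ?divr_ge0 ?(ltW rho0) // ltr_pdivrMr // mul1r.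
Qed.

Definition psum f (z : C) n : 'cV[C]_N := \sum_(k < n) z ^+ k *: f k.

Definition circle (r t : R) : C := Defs.cscale r (expi t).

Lemma circleX r t m :
  circle r t ^+ m = Complex (r ^+ m * cos (m%:R * t)) (r ^+ m * sin (m%:R * t)).
Proof.
elim: m => [|m IH].
  by rewrite mul0r cos0 sin0 !expr0; apply: complexP; rewrite !ReIm /=; ring.
rewrite exprS IH -natr1 mulrDl mul1r cosD sinD.
by apply: complexP; rewrite !ReIm /= exprS; ring.
Qed.

Lemma rv_circle f r t k m :
  rv (circle r t ^+ k *: f k) (circle r t ^+ (m + k) *: f (m + k)%N) =
  r ^+ k ^+ 2 * r ^+ m * re (vdot (f k) (f (m + k)%N)) * cos (m%:R * t) +
  r ^+ k ^+ 2 * r ^+ m * im (vdot (f k) (f (m + k)%N)) * sin (m%:R * t).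
Proof.
rewrite /rv vdotZl vdotZr exprD cconjM.
set z := vdot _ _.
have -> : circle r t ^+ k * (cconj (circle r t ^+ m) * cconj (circle r t ^+ k) * z)
  = (cconj (circle r t ^+ k) * circle r t ^+ k) * (cconj (circle r t ^+ m) * z) by ring.
rewrite mulcconj cabs2X.
have -> : cabs2 (circle r t) = r ^+ 2.
  by rewrite /cabs2 /= !exprMn -mulrDr cos2Dsin2 mulr1.
by rewrite circleX !ReIm /= -!exprM mulnC; ring.
Qed.

(** Adding the coefficient [f n] contributes its weighted squared norm, constant in t, and cross
    terms of frequency n - k > 0, which integrate to 0 over a period. *)
Lemma primitive_psum f r n : primitive_on 0 (2 * pi)
  (fun t => vnorm2 (psum f (circle r t) n))
  (2 * pi * \sum_(k < n) r ^+ k ^+ 2 * vnorm2 (f k)).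
Proof.
elim: n => [|n IH].
  rewrite big_ord0 mulr0 (_ : (fun t => _) = fun=> 0).
    by have := @primitive_on_cst R 0 (2 * pi) 0; rewrite mul0r.
  by apply/funext => t; rewrite /psum big_ord0 vnorm20.
rewrite big_ord_recr /= (mulrDr (2 * pi)).
pose c k m := r ^+ k ^+ 2 * r ^+ m.
pose tr k t : R := 2 * c k (n - k)%N * re (vdot (f k) (f n)) * cos ((n - k)%:R * t)
  + 2 * c k (n - k)%N * im (vdot (f k) (f n)) * sin ((n - k)%:R * t).
have -> : (fun t => vnorm2 (psum f (circle r t) n.+1)) = (fun t =>
    vnorm2 (psum f (circle r t) n) + (\sum_(k < n) tr k t + r ^+ n ^+ 2 * vnorm2 (f n))).
  apply/funext => t; rewrite {1}/psum big_ord_recr /= -/(psum _ _ _) vnorm2D -addrA.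
  congr (_ + (_ + _)); last first.
    rewrite vnorm2E; have := rv_circle f r t n 0; rewrite !add0n => ->.
    by rewrite mul0r cos0 sin0 vnorm2E /rv; ring.
  rewrite /psum /rv (big_morph (fun x => vdot x _) (fun x y => vdotDl x y _) (vdot0l _)).
  rewrite re_sum mulr_sumr; apply: eq_bigr => k _.
  have kn : (n - k + k)%N = n by rewrite subnK // ltnW.
  have := rv_circle f r t k (n - k)%N; rewrite kn /rv => ->.
  by rewrite /tr /c; ring.
apply: (primitive_onD IH); rewrite -[X in primitive_on _ _ _ X]add0r.
apply: (@primitive_onD _ _ _ (fun t => \sum_(k < n) tr k t) (fun=> r ^+ n ^+ 2 * vnorm2 (f n))).
  rewrite [X in primitive_on _ _ _ X](_ : 0 = \sum_(k < n) (fun=> 0) (k : nat)); last by rewrite big1.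
  apply: (@primitive_on_sum _ _ _ n tr (fun=> 0)) => k kn.
  by apply: primitive_on_trig; rewrite subn_gt0.
by have := @primitive_on_cst R 0 (2 * pi) (r ^+ n ^+ 2 * vnorm2 (f n)); rewrite subr0 (mulrC _ (2 * pi)).
Qed.

Lemma psum_bounded f (r : R) : 0 <= r ->
  (forall i, cvgn (series (fun k => `|re (f k i 0)| * r ^+ k)) /\
             cvgn (series (fun k => `|im (f k i 0)| * r ^+ k))) ->
  exists M, forall n t, vnorm2 (psum f (circle r t) n) <= M.
Proof.
move=> r0 cf.
pose K i := limn (series (fun k => `|re (f k i 0)| * r ^+ k)) +
            limn (series (fun k => `|im (f k i 0)| * r ^+ k)).
exists (\sum_i 2 * K i ^+ 2) => n t; apply: ler_sum => i _.
have K0 : \sum_(k < n) (`|re (f k i 0)| + `|im (f k i 0)|) * r ^+ k <= K i.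
  under eq_bigr do rewrite mulrDl; rewrite big_split /=; have [c1 c2] := cf i.
  by apply: lerD; apply: (@series_partial_le _ (fun k => `|_ (f k i 0)| * _)) => // k; rewrite mulr_ge0 ?exprn_ge0.
have csle (z : C) k : `|re (circle r t ^+ k * z)| <= (`|re z| + `|im z|) * r ^+ k /\
    `|im (circle r t ^+ k * z)| <= (`|re z| + `|im z|) * r ^+ k.
  rewrite circleX !ReIm /= -!mulrA -mulrBr -mulrDr !normrM (ger0_norm (exprn_ge0 _ r0)).
  rewrite !(mulrC (r ^+ k)) !ler_wpM2r ?exprn_ge0 //.
    apply: le_trans (ler_normD _ _) _; rewrite addrC !normrM; apply: lerD.
      by rewrite ler_piMl // ler_norml; apply/andP; split; [exact: sin_geN1 | exact: sin_le1].
    by rewrite ler_piMl // ler_norml; apply/andP; split; [exact: cos_geN1 | exact: cos_le1].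
  apply: le_trans (ler_normB _ _) _; rewrite !normrM; apply: lerD.
    by rewrite ler_piMl // ler_norml; apply/andP; split; [exact: cos_geN1 | exact: cos_le1].
  by rewrite ler_piMl // ler_norml; apply/andP; split; [exact: sin_geN1 | exact: sin_le1].
have [reK imK] : `|re (psum f (circle r t) n i 0)| <= K i /\
                 `|im (psum f (circle r t) n i 0)| <= K i.
  rewrite /psum summxE re_sum im_sum; split.
    apply: le_trans (ler_norm_sum _ _ _) (le_trans _ K0); apply: ler_sum => k _.
    by rewrite mxE; have [] := csle (f k i 0) k.
  apply: le_trans (ler_norm_sum _ _ _) (le_trans _ K0); apply: ler_sum => k _.
  by rewrite mxE; have [] := csle (f k i 0) k.
rewrite /cabs2 -(real_normK (num_real (re _))) -(real_normK (num_real (im _))).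
have := normr_ge0 (re (psum f (circle r t) n i 0)).
have := normr_ge0 (im (psum f (circle r t) n i 0)); nra.
Qed.

(** Absolute convergence bounds the partial sums uniformly in n and t, which is the domination
    needed to integrate the limit. Measurability is part of the conclusion because [V] is known only
    as a pointwise limit of continuous functions. *)
Lemma parseval f (r : R) V : 0 <= r ->
  (forall i, cvgn (series (fun k => `|re (f k i 0)| * r ^+ k)) /\
             cvgn (series (fun k => `|im (f k i 0)| * r ^+ k))) ->
  (forall t, vcvg (psum f (circle r t)) (V t)) ->
  measurable_fun `[0, 2 * pi] (fun t => vnorm2 (V t)) /\
  exists2 S, (fun n => \sum_(k < n) r ^+ k ^+ 2 * vnorm2 (f k)) @ \oo --> S &
    (\int[mu]_(t in `[0%R, (2 * pi)%R]) (vnorm2 (V t))%:E = (2 * pi * S)%R%:E)%E.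
Proof.
move=> r0 cf fV; have [M bM] := psum_bounded r0 cf.
have pi0 : 0 < 2 * pi :> R by rewrite mulr_gt0 // pi_gt0.
have mP n : measurable_fun `[0, 2 * pi] (fun t => vnorm2 (psum f (circle r t) n)).
  apply: measurable_funTS; apply: measurable_realfun.continuous_measurable_fun.
  by have [] := primitive_psum f r n.
have mV : measurable_fun `[0, 2 * pi] (fun t => vnorm2 (V t)).
  apply: (measurable_realfun.measurable_fun_cvg mP) => t _.
  exact: vcvg_vnorm2.
split => //.
have [||||J JE Jlim] := @bounded_convergence R 0 (2 * pi) _ _ M set0 mP mV.
- exact: measurable0.
- exact: measure0.
- by move=> t _ _; exact: vcvg_vnorm2.
- by move=> n t _; rewrite ger0_norm ?vnorm2_ge0.
exists (J / (2 * pi)); last by rewrite JE mulrC divfK ?gt_eqF.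
have := Jlim _ (fun n => primitive_integral pi0 (primitive_psum f r n)).
move=> h; rewrite mulrC (_ : (fun n => _) = (fun n => (2 * pi)^-1 *
    (2 * pi * \sum_(k < n) r ^+ k ^+ 2 * vnorm2 (f k)))); first exact: cvgMr.
by apply/funext => n; rewrite mulKf ?gt_eqF.
Qed.

End ComplexConvergence.

(** * Multiplication by an inner function *)

Section Multiplication.
Context (R : realType) (N : nat).
Local Notation C := (complex R).
Local Notation seqs := (nat -> 'cV[C]_N).
Local Notation mu := (@lebesgue_measure R).
Context (A : nat -> 'M[C]_N).
Implicit Types (f g p : seqs) (z : C) (x : 'cV[C]_N).

Lemma mulThetaD f g : mulTheta A (f + g) = mulTheta A f + mulTheta A g.
Proof.
apply/funext => k; rewrite /mulTheta [RHS]/GRing.add /= -big_split /=.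
by apply: eq_bigr => j _; rewrite -mulmxDr.
Qed.

Lemma mulThetaZ c f : mulTheta A (c *: f) = c *: mulTheta A f.
Proof.
apply/funext => k; rewrite /mulTheta [RHS]/GRing.scale /= scaler_sumr.
by apply: eq_bigr => j _; rewrite -scalemxAr.
Qed.

(** Multiplication by Theta commutes with z. This recursion drives the induction on the degree of a
    polynomial and the description of [K]. *)
Lemma mulTheta_hcons x f :
  mulTheta A (hcons x f) = (fun k => A k *m x) + hcons 0 (mulTheta A f).
Proof.
apply/funext => k; rewrite /mulTheta [RHS]/GRing.add /= big_ord_recr /= subnn addrC.
congr (_ + _); case: k => [|k]; first by rewrite big_ord0.
by apply: eq_bigr => j _; rewrite subSn // -ltnS.
Qed.

Lemma mulTheta0 : mulTheta A 0 = 0.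
Proof. by rewrite -[X in mulTheta _ X](scale0r (0 : seqs)) mulThetaZ scale0r. Qed.

Lemma hcons00 : hcons 0 0 = 0 :> seqs.
Proof. by apply/funext => -[]. Qed.

Lemma mulTheta_hcst x : mulTheta A (hcst x) = fun k => A k *m x.
Proof. by rewrite mulTheta_hcons mulTheta0 hcons00 addr0. Qed.

Lemma psumD f g z n : psum (f + g) z n = psum f z n + psum g z n.
Proof. by rewrite /psum -big_split; apply: eq_bigr => k _; rewrite scalerDr. Qed.

Lemma psum_hcons x f z n : psum (hcons x f) z n.+1 = x + z *: psum f z n.
Proof.
rewrite /psum big_ord_recl /= expr0 scale1r scaler_sumr; congr (_ + _).
by apply: eq_bigr => k _; rewrite scalerA -exprS.
Qed.

Lemma psum_coef_cvg z x : (forall i j, csum_cvg (fun k => A k i j * z ^+ k)) ->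
  vcvg (psum (fun k => A k *m x) z) (ps_eval A z *m x).
Proof.
move=> cA; have -> : psum (fun k => A k *m x) z =
    fun n => (\sum_(k < n) z ^+ k *: A k) *m x.
  apply/funext => n; rewrite mulmx_suml; apply: eq_bigr => k _.
  by rewrite -scalemxAl.
apply: vcvg_mulmx; last exact: vcvg_cst.
move=> i j; rewrite mxE; have := ccvg_csum (cA i j); congr ccvg.
by apply/funext => n; rewrite summxE; apply: eq_bigr => k _; rewrite mxE mulrC.
Qed.

(** Induction on the degree of [p], peeling off its constant coefficient, so no Cauchy product of
    two infinite series has to be summed. *)
Lemma mulTheta_psum_cvg z p n :
  (forall i j, csum_cvg (fun k => A k i j * z ^+ k)) ->
  (forall k, (n <= k)%N -> p k = 0) ->
  vcvg (psum (mulTheta A p) z) (ps_eval A z *m psum p z n).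
Proof.
move=> cA; elim: n p => [|n IH] p p0.
  have -> : p = 0 by apply/funext => k; exact: p0.
  rewrite mulTheta0 /psum big_ord0 mulmx0.
  rewrite (_ : (fun n => _) = fun=> 0); first exact: vcvg_cst.
  by apply/funext => n; rewrite big1 // => k _; rewrite scaler0.
rewrite -(hcons_behead p) mulTheta_hcons psum_hcons mulmxDr.
have -> : psum ((fun k => A k *m p 0%N) + hcons 0 (mulTheta A (fun k => p k.+1))) z =
   (fun n => psum (fun k => A k *m p 0%N) z n + psum (hcons 0 (mulTheta A (fun k => p k.+1))) z n).
  by apply/funext => m; rewrite psumD.
apply: vcvgD; first exact: psum_coef_cvg.
apply: vcvg_shiftS; under eq_fun do rewrite psum_hcons add0r.
rewrite -scalemxAr; apply: vcvgZ; apply: IH => k kn; exact: p0.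
Qed.

Lemma psum_disk_bounded p n : exists2 M, 0 <= M &
  forall z, cabs2 z <= 1 -> vnorm2 (psum p z n) <= M.
Proof.
elim: n => [|n [M M0 IH]].
  by exists 0 => // z _; rewrite /psum big_ord0 vnorm20.
exists (2 * M + 2 * vnorm2 (p n)).
  by rewrite addr_ge0 // mulr_ge0 // vnorm2_ge0.
move=> z z1; rewrite /psum big_ord_recr /=; apply: le_trans (vnorm2D_le _ _) _.
rewrite lerD ?ler_pM2l ?IH // vnorm2Z cabs2X ler_piMl ?vnorm2_ge0 //.
by rewrite exprn_ile1 ?cabs2_ge0.
Qed.

Lemma cabs2_circle (r t : R) : cabs2 (circle r t) = r ^+ 2.
Proof. by rewrite /cabs2 /= !exprMn -mulrDr cos2Dsin2 mulr1. Qed.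

(** For nonnegative terms Abel summability implies convergence: a fixed partial sum is the limit of
    its weighted versions, each at most [S m], hence is at most [s]. Conversely the weights are at
    most 1, so every [S m] is at most the sum. *)
Lemma abel_sum (u S : nat -> R) (rho : nat -> R) (s : R) :
  (forall k, 0 <= u k) -> (forall m, 0 <= rho m <= 1) -> rho @ \oo --> (1 : R) ->
  (forall m, (fun j => \sum_(k < j) rho m ^+ k ^+ 2 * u k) @ \oo --> S m) ->
  S @ \oo --> s -> cvgn (series u) /\ limn (series u) = s.
Proof.
move=> u0 rho01 rho1 cS Ss.
have term0 m k : 0 <= rho m ^+ k ^+ 2 * u k by rewrite mulr_ge0 ?sqr_ge0.
have partS m j : \sum_(k < j) rho m ^+ k ^+ 2 * u k <= S m.
  have := cS m; rewrite (_ : (fun j => _) = series (fun k => rho m ^+ k ^+ 2 * u k)).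
    move=> h; rewrite -(cvg_lim _ h) //.
    by apply: (@series_partial_le _ (fun k => rho m ^+ k ^+ 2 * u k)) => //; apply/cvg_ex; exists (S m).
  by apply/funext => i; rewrite /series /= big_mkord.
have parts j : \sum_(k < j) u k <= s.
  have h : (fun m => \sum_(k < j) rho m ^+ k ^+ 2 * u k) @ \oo --> \sum_(k < j) u k.
    elim: j => [|j IH].
      by rewrite big_ord0; under eq_fun do rewrite big_ord0; exact: cvg_cst.
    rewrite big_ord_recr /=; under eq_fun do rewrite big_ord_recr /=.
    apply: cvgD => //; rewrite -[X in _ --> X]mul1r; apply: cvgMl.
    have pw i : (fun m => rho m ^+ i) @ \oo --> (1 : R).
      elim: i => [|i IHi]; first by under eq_fun do rewrite expr0; exact: cvg_cst.
      under eq_fun do rewrite exprS.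
      have h : (rho \* (fun m => rho m ^+ i)) @ \oo --> (1 * 1 : R) by exact: cvgM.
      by rewrite mulr1 in h.
    by under eq_fun do rewrite -exprM; exact: pw.
  rewrite -(cvg_lim _ h) // -(cvg_lim _ Ss) //; apply: ler_lim.
  - by apply/cvg_ex; exists (\sum_(k < j) u k).
  - by apply/cvg_ex; exists s.
  - by apply: nearW => m; exact: partS.
have [cu us] := series_bounded_cvg u0 parts; split => //; apply/le_anti; rewrite us /=.
rewrite -(cvg_lim _ Ss) //; apply: limr_le; first by apply/cvg_ex; exists s.
apply: nearW => m; rewrite -(cvg_lim _ (cS m)) //; apply: limr_le.
  by apply/cvg_ex; exists (S m).
apply: nearW => j; apply: le_trans (series_partial_le j u0 cu); apply: ler_sum => k _.
have /andP[r0 r1] := rho01 m.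
by rewrite ler_piMl // exprn_ile1 ?exprn_ge0 ?exprn_ile1.
Qed.

(** Radii along a sequence, as dominated convergence requires. The shift [m.+2] keeps them strictly
    positive, as [radial_limit] demands. *)
Let rho (m : nat) : R := 1 - m.+2%:R^-1.

Let rho_bnd m : 0 <= rho m < 1.
Proof.
rewrite /rho subr_ge0 invf_le1 ?ltr0n // ler1n /= ltrBlDr ltrDl invr_gt0 ltr0n //.
Qed.

Let rho_cvg : rho @ \oo --> (1 : R).
Proof.
rewrite -[X in _ --> X]subr0; apply: cvgB; first exact: cvg_cst.
by have := @cvg_harmonic R; rewrite -cvg_shiftS.
Qed.

Hypothesis innerA : inner_fn A.

Let csumA (r t : R) : 0 <= r < 1 ->
  forall i j, csum_cvg (fun k => A k i j * circle r t ^+ k).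
Proof.
move=> /andP[r0 r1]; have [[cA _] _] := innerA; apply: cA.
by rewrite /in_disk cabs2_circle expr_lt1.
Qed.

(** At angle 0 the point of radius [r'] is real, so convergence there separates into the real and
    imaginary parts of the coefficients; Abel's lemma between [r] and the midpoint [r'] of [r] and 1
    makes it absolute. *)
Lemma mulTheta_finsupp_abs p n (r : R) : 0 <= r < 1 ->
  (forall k, (n <= k)%N -> p k = 0) -> forall i,
  cvgn (series (fun k => `|re (mulTheta A p k i 0)| * r ^+ k)) /\
  cvgn (series (fun k => `|im (mulTheta A p k i 0)| * r ^+ k)).
Proof.
move=> /andP[r0 r1] p0 i; set r' := (r + 1) / 2.
have r'01 : 0 <= r' < 1 by rewrite /r'; apply/andP; split; lra.
have rr' : r < r' by rewrite /r'; lra.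
have [hre him] := mulTheta_psum_cvg (csumA 0 r'01) p0 i.
have E k : circle r' 0 ^+ k = Complex (r' ^+ k) 0.
  by rewrite circleX mulr0 cos0 sin0 mulr1 mulr0.
have Ere : series (fun k => re (mulTheta A p k i 0) * r' ^+ k) =
    fun m => re (psum (mulTheta A p) (circle r' 0) m i 0).
  apply/funext => m; rewrite /psum summxE re_sum /series /= big_mkord.
  by apply: eq_bigr => k _; rewrite mxE E reM /=; ring.
have Eim : series (fun k => im (mulTheta A p k i 0) * r' ^+ k) =
    fun m => im (psum (mulTheta A p) (circle r' 0) m i 0).
  apply/funext => m; rewrite /psum summxE im_sum /series /= big_mkord.
  by apply: eq_bigr => k _; rewrite mxE E imM /=; ring.
by split; apply: (power_series_abs r0 rr'); apply/cvg_ex; eexists;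
  [rewrite Ere; exact: hre | rewrite Eim; exact: him].
Qed.

Lemma radial_limit_ccvg t B : radial_limit A t B ->
  forall i j, ccvg (fun m => ps_eval A (circle (rho m) t) i j) (B i j).
Proof.
move=> AB i j.
have close e : 0 < e -> \forall m \near \oo,
    cabs2 (ps_eval A (circle (rho m) t) i j - B i j) < e.
  move=> e0; have [d [d0 dP]] := AB _ e0.
  have h : \forall m \near \oo, 1 - d < rho m.
    by apply: (cvgr_gt (1 : R) rho_cvg); rewrite ltrBlDr ltrDl.
  near=> m; apply: dP; last by have /andP[] := rho_bnd m.
    rewrite /rho subr_gt0 invf_lt1 ?ltr0n // ltr1n //.
  by near: m.
split; apply/cvgrPdist_lt => e e0; have := close (e ^+ 2) (exprn_gt0 _ e0);
  apply: filterS => m h; rewrite -ltr_sqr ?nnegrE ?normr_ge0 ?(ltW e0) //;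
  rewrite real_normK ?num_real //; apply: le_lt_trans h.
  by rewrite -sqrrN opprB -reN -reD sqr_re_le.
by rewrite -sqrrN opprB -imN -imD sqr_im_le.
Unshelve. all: by end_near. Qed.

Lemma circle_ccvg t k : ccvg (fun m => circle (rho m) t ^+ k) (circle 1 t ^+ k).
Proof.
elim: k => [|k IH]; first by rewrite expr0; under eq_fun do rewrite expr0; exact: ccvg_cst.
rewrite exprS; under eq_fun do rewrite exprS; apply: ccvgM => //.
by split => /=; apply: cvgMl; exact: rho_cvg.
Qed.

(** Polynomials come first because [p] is bounded on the closed disk and continuous up to the
    circle, so only Theta has delicate boundary values. Off the null set |Theta p|^2 tends radially
    to |B p|^2 = |p|^2 with [B] isometric; the integrals converge, and [abel_sum] converts the limit
    of the weighted sums into the norm of Theta p. *)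
Lemma mulTheta_finsupp p n : (forall k, (n <= k)%N -> p k = 0) ->
  in_H2 (mulTheta A p) /\ rd (mulTheta A p) (mulTheta A p) = rd p p.
Proof.
move=> p0.
have pi0 : 0 < 2 * pi :> R by rewrite mulr_gt0 // pi_gt0.
pose V m t := ps_eval A (circle (rho m) t) *m psum p (circle (rho m) t) n.
have PV m := parseval (proj1 (andP (rho_bnd m)))
  (mulTheta_finsupp_abs (rho_bnd m) p0)
  (fun t => mulTheta_psum_cvg (csumA t (rho_bnd m)) p0).
have SP m : exists s,
    (fun j => \sum_(k < j) rho m ^+ k ^+ 2 * vnorm2 (mulTheta A p k)) @ \oo --> s /\
    (\int[mu]_(t in `[0%R, (2 * pi)%R]) (vnorm2 (V m t))%:E = (2 * pi * s)%R%:E)%E.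
  by have [_ [s ? ?]] := PV m; exists s.
have {SP}[S SP] := choice SP.
have [[_ [c cP]] [E [mE [E0 EP]]]] := innerA.
have [M M0 bp] := psum_disk_bounded p n.
have rho1 m t : cabs2 (circle (rho m) t) < 1.
  by have /andP[? ?] := rho_bnd m; rewrite cabs2_circle expr_lt1.
(* The bound [c] on Theta is not assumed nonnegative, hence the absolute value in the dominating
   constant. *)
have [|||J JE Jlim] := @bounded_convergence R 0 (2 * pi)
  (fun m t => vnorm2 (V m t)) (fun t => vnorm2 (psum p (circle 1 t) n)) (`|c| * M) E
  (fun m => proj1 (PV m)) _ mE E0.
- apply: measurable_funTS; apply: measurable_realfun.continuous_measurable_fun.
  by have [] := primitive_psum p 1 n.
- move=> t /andP[t0 t2] /(EP _ t0 t2)[B [rB iB]].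
  rewrite -(vnorm2_isometry _ iB); apply: vcvg_vnorm2.
  apply: vcvg_mulmx; first exact: radial_limit_ccvg.
  move=> i; under eq_fun do rewrite summxE; rewrite summxE; apply: ccvg_sum => k.
  under eq_fun do rewrite mxE; rewrite mxE; apply: ccvgM; last exact: ccvg_cst.
  exact: circle_ccvg.
- move=> m t _; rewrite ger0_norm ?vnorm2_ge0 //; apply: le_trans (cP _ (rho1 m t) _) _.
  apply: le_trans (ler_wpM2r (vnorm2_ge0 _) (ler_norm c)) _.
  by apply: ler_wpM2l => //; apply: bp; exact: ltW.
have JE' : J = 2 * pi * rd p p.
  have := primitive_integral pi0 (primitive_psum p 1 n); rewrite JE => -[->].
  have [_ ->] := in_H2_finsupp p0; congr (_ * _).
  by apply: eq_bigr => k _; rewrite !expr1n mul1r.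
have Slim : S @ \oo --> rd p p.
  have := Jlim _ (fun m => proj2 (SP m)); rewrite JE' => h.
  have pi1 : 2 * pi != 0 :> R by rewrite gt_eqF.
  rewrite -[rd p p](mulKf pi1) (_ : S = fun m => (2 * pi)^-1 * (2 * pi * S m)).
    exact: cvgMr h.
  by apply/funext => m; rewrite mulKf.
have rho01 m : 0 <= rho m <= 1 by have /andP[-> /ltW ->] := rho_bnd m.
have [cu lu] := abel_sum (fun k => vnorm2_ge0 (mulTheta A p k)) rho01 rho_cvg (fun m => proj1 (SP m)) Slim.
by split => //; rewrite rdE.
Qed.

Lemma trunc_finsupp n f k : (n <= k)%N -> trunc n f k = 0.
Proof. by rewrite /trunc ltnNge => ->. Qed.

Lemma mulTheta_trunc n f k : (k < n)%N -> mulTheta A (trunc n f) k = mulTheta A f k.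
Proof.
move=> kn; apply: eq_bigr => j _; rewrite /trunc.
by rewrite (leq_ltn_trans (leq_subr j k) kn).
Qed.

(** The first n coefficients of Theta f depend only on the first n of [f], so the polynomial case
    bounds every partial sum. *)
Lemma mulTheta_contraction f : in_H2 f ->
  in_H2 (mulTheta A f) /\ rd (mulTheta A f) (mulTheta A f) <= rd f f.
Proof.
move=> Hf; apply: H2_bounded => n.
have [HT TE] := mulTheta_finsupp (@trunc_finsupp n f).
have [_ tE] := in_H2_finsupp (@trunc_finsupp n f).
under eq_bigr => k _ do rewrite -(mulTheta_trunc f (ltn_ord k)).
apply: le_trans (rd_partial n HT) _; rewrite TE tE.
apply: le_trans (rd_partial n Hf); apply: ler_sum => k _.
by rewrite /trunc ltn_ord.
Qed.

Lemma in_H2_mulTheta f : in_H2 f -> in_H2 (mulTheta A f).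
Proof. by case/mulTheta_contraction. Qed.

(* [q f = |f|^2 - |Theta f|^2] is a nonnegative quadratic form vanishing on
   polynomials, so the parallelogram law gives [q f <= 2 q (f - t) <= 2 |f - t|^2]
   for every polynomial [t]. *)
Lemma mulTheta_norm f : in_H2 f -> rd (mulTheta A f) (mulTheta A f) = rd f f.
Proof.
move=> Hf; have [HTf Tf] := mulTheta_contraction Hf.
apply/le_anti; rewrite Tf /= -subr_le0; apply: (@le_epsilon_lin _ _ 2) => // e e0.
have [n ne] := trunc_cvg Hf e0; set t := trunc n f in ne.
have [Ht _] := in_H2_finsupp (@trunc_finsupp n f).
have [HTt Tt] := mulTheta_finsupp (@trunc_finsupp n f).
rewrite -/t in Ht HTt Tt; set d := f - t in ne.
have Hd : in_H2 d by exact: in_H2B.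
have [HTd Td] := mulTheta_contraction Hd.
have [HTtd] := mulTheta_contraction (in_H2B Ht Hd).
rewrite -[- d]scaleN1r mulThetaD mulThetaZ !scaleN1r.
have -> : f = t + d by rewrite addrC subrK.
have := rd_ge0 HTd.
rewrite mulThetaD rdB_sqr // rdB_sqr // rdD_sqr // rdD_sqr // Tt; lra.
Qed.

Lemma mulTheta_isometry f g : in_H2 f -> in_H2 g ->
  rd (mulTheta A f) (mulTheta A g) = rd f g.
Proof.
move=> Hf Hg; have := mulTheta_norm (in_H2D Hf Hg).
have HTf := in_H2_mulTheta Hf; have HTg := in_H2_mulTheta Hg.
by rewrite mulThetaD !rdD_sqr // !mulTheta_norm //; lra.
Qed.

End Multiplication.

(** * The model operator and its unitary dilations *)

Section ModelOperators.
Context (R : realType) (N : nat).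
Local Notation C := (complex R).
Local Notation seqs := (nat -> 'cV[C]_N).
Context (A : nat -> 'M[C]_N).
Hypothesis innerA : inner_fn A.
Implicit Types (f g h : seqs) (c : C) (x y w : 'cV[C]_N).
Local Notation T := (mulTheta A).
Local Notation K := (KTheta A).

Lemma hcstD x y : hcst (x + y) = hcst x + hcst y.
Proof. by rewrite hconsD addr0. Qed.
Lemma hcstZ c x : hcst (c *: x) = c *: hcst x.
Proof. by rewrite hconsZ scaler0. Qed.

(* The constant coefficient of [Theta^* g]. *)
Definition top g : 'cV[C]_N := \col_i h2dot g (T (hcst (delta_mx i 0))).

Lemma in_H2_T x : in_H2 (T (hcst x)).
Proof. exact/in_H2_mulTheta/in_H2_hcst. Qed.
Arguments in_H2_T x : clear implicits.

Lemma topP g x : in_H2 g -> rd g (T (hcst x)) = rv (top g) x.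
Proof.
move=> Hg; rewrite /rv /vdot re_sum.
have -> : T (hcst x) = \sum_i x i 0 *: T (hcst (delta_mx i 0)).
  rewrite mulTheta_hcst; apply/funext => k.
  rewrite [RHS](big_morph (fun f : seqs => f k) (id1 := 0) (op1 := +%R)) //.
  rewrite {1}(matrix_sum_delta x) mulmx_sumr; apply: eq_bigr => i _.
  by rewrite big_ord1 -scalemxAr mulTheta_hcst.
have HF i : in_H2 (x i 0 *: T (hcst (delta_mx i 0))) by exact/in_H2Z/in_H2_T.
have [_ ->] := rd_sumr (index_enum _) Hg HF; apply: eq_bigr => i _.
by rewrite -h2dot_re_conj //; [rewrite mxE mulrC | exact: in_H2_T].
Qed.

Lemma topD f g : in_H2 f -> in_H2 g -> top (f + g) = top f + top g.
Proof.
move=> Hf Hg; apply: rv_inj => x; rewrite -topP; last exact: in_H2D.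
by rewrite rdDl //; [rewrite !topP // rvDl | exact: in_H2_T].
Qed.

Lemma topZ c g : in_H2 g -> top (c *: g) = c *: top g.
Proof.
move=> Hg; apply: rv_inj => x; rewrite -topP; last exact: in_H2Z.
by rewrite rdZl -mulThetaZ -hcstZ topP // rvZ.
Qed.

(* [g] projected onto the orthogonal complement of [Theta C^N]. *)
Definition mproj g : seqs := g - T (hcst (top g)).

Lemma in_H2_mproj g : in_H2 g -> in_H2 (mproj g).
Proof. by move=> Hg; apply: in_H2B => //; exact: in_H2_T. Qed.

Lemma mprojD f g : in_H2 f -> in_H2 g -> mproj (f + g) = mproj f + mproj g.
Proof.
by move=> Hf Hg; rewrite /mproj topD // hcstD mulThetaD opprD addrACA.
Qed.

Lemma mprojZ c g : in_H2 g -> mproj (c *: g) = c *: mproj g.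
Proof. by move=> Hg; rewrite /mproj topZ // hcstZ mulThetaZ scalerBr. Qed.

Lemma rd_hcst x y : rd (hcst x) (hcst y) = rv x y.
Proof. by rewrite rd_hcons ?rd0l ?addr0 //; exact: in_H20. Qed.

(** Polarized Pythagoras for the splitting along Theta C^N, a space on which [top] is an isometric
    coordinate because Theta is isometric. It gives the contractivity of [Sop], the isometry of
    [Uop] and the unitarity of the matrix [E] below. *)
Lemma rd_mproj f g : in_H2 f -> in_H2 g ->
  rd (mproj f) (mproj g) + rv (top f) (top g) = rd f g.
Proof.
move=> Hf Hg; have HTf := in_H2_T (top f); have HTg := in_H2_T (top g).
have HPg : in_H2 (g - T (hcst (top g))) by exact: in_H2B.
rewrite /mproj rdBl // !rdBr // topP // mulTheta_isometry //; try exact: in_H2_hcst.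
by rewrite rd_hcst (rdC (T _) g) topP // (rvC (top g)); ring.
Qed.

(** Theta H^2 is a complex subspace, so testing with [i f] as well recovers the imaginary part. *)
Lemma KThetaP g : K g <-> in_H2 g /\ forall f, in_H2 f -> rd g (T f) = 0.
Proof.
split=> [[Hg gK]|[Hg gK]]; split => // f Hf.
  by have := gK f Hf; rewrite h2dotE => -[].
by rewrite h2dotE -mulThetaZ !gK //; exact: in_H2Z.
Qed.

Lemma K_H2 f : K f -> in_H2 f. Proof. by case. Qed.

Lemma K0 : K 0.
Proof. by apply/KThetaP; split => [|f _]; [exact: in_H20 | rewrite rd0l]. Qed.

Lemma KD f g : K f -> K g -> K (f + g).
Proof.
move=> /KThetaP[Hf fK] /KThetaP[Hg gK]; apply/KThetaP; split; first exact: in_H2D.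
by move=> h Hh; rewrite rdDl ?fK ?gK ?addr0 //; exact: in_H2_mulTheta.
Qed.

Lemma KZ c f : K f -> K (c *: f).
Proof.
move=> /KThetaP[Hf fK]; apply/KThetaP; split; first exact: in_H2Z.
by move=> h Hh; rewrite rdZl -mulThetaZ fK //; exact: in_H2Z.
Qed.

Lemma KB f g : K f -> K g -> K (f - g).
Proof. by move=> Kf Kg; rewrite -scaleN1r; apply: KD => //; exact: KZ. Qed.

(** Split a test function as q = q(0) + z q'. The part z Theta q' is orthogonal to x + z f because
    [f] is in [K], and to Theta C^N because Theta is isometric; the part Theta q(0) is what [top]
    removes. *)
Lemma K_mproj x f : K f -> K (mproj (hcons x f)).
Proof.
move=> /KThetaP[Hf fK]; have Hg : in_H2 (hcons x f) by exact: in_H2_hcons.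
apply/KThetaP; split; first exact: in_H2_mproj.
move=> q Hq; have HTq := in_H2_mulTheta innerA Hq.
rewrite /mproj rdBl //; last exact: in_H2_T.
rewrite mulTheta_isometry //; last exact: in_H2_hcst.
have Hq' := in_H2_behead Hq.
have HTq' := in_H2_mulTheta innerA Hq'.
have E1 := topP (q 0%N) Hg.
have E2 := rd_hcons x 0 Hf HTq'.
have E3 := rd_hcons (top (hcons x f)) (q 0%N) (@in_H20 R N) Hq'.
rewrite -[X in rd _ (T X) - _](hcons_behead q) -[X in _ - rd _ X](hcons_behead q).
rewrite mulTheta_hcons -mulTheta_hcst rdDr //; last 2 first.
- exact: in_H2_T.
- exact: in_H2_hcons.
by rewrite E1 E2 E3 fK // rd0l (rvC x) rv0l !addr0 subrr.
Qed.

Definition Sop f := mproj (hcons 0 f).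

Lemma in_H2_hcons0 f : in_H2 f -> in_H2 (hcons 0 f).
Proof. exact: in_H2_hcons. Qed.

Lemma K_Sop f : K f -> K (Sop f). Proof. exact: K_mproj. Qed.

Lemma SopD f g : in_H2 f -> in_H2 g -> Sop (f + g) = Sop f + Sop g.
Proof.
move=> Hf Hg; rewrite /Sop -mprojD; try exact: in_H2_hcons.
by rewrite hconsD addr0.
Qed.

Lemma SopZ c f : in_H2 f -> Sop (c *: f) = c *: Sop f.
Proof.
move=> Hf; rewrite /Sop -mprojZ; last exact: in_H2_hcons.
by rewrite hconsZ scaler0.
Qed.

Lemma Sop_contraction f : in_H2 f -> rd (Sop f) (Sop f) <= rd f f.
Proof.
move=> Hf; have := rd_mproj (in_H2_hcons 0 Hf) (in_H2_hcons 0 Hf).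
rewrite rd_hcons // rv0l add0r => <-.
by rewrite lerDl -vnorm2E vnorm2_ge0.
Qed.

(** The residual z f - [Sop f] lies in Theta C^N, hence is orthogonal to [K], which gives existence
    of the projection. Uniqueness follows by testing two candidates against their difference. *)
Lemma S_graphP f g : K f -> S_graph A f g <-> g = Sop f.
Proof.
move=> Kf; have Hf := K_H2 Kf; have Hsf := in_H2_hcons0 Hf.
have proj : forall h, K h -> rd (h2sub (shiftz f) (Sop f)) h = 0.
  move=> h /KThetaP[Hh hK].
  have -> : h2sub (shiftz f) (Sop f) = T (hcst (top (hcons 0 f))).
    rewrite shiftzE; apply/funext => k; rewrite /h2sub /Sop /mproj.
    by rewrite [(_ - _ : seqs) k]/GRing.add /= opprB addrC subrK.
  by rewrite rdC hK //; exact: in_H2_hcst.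
split=> [[Kg gP]|->]; last first.
  split; first exact: K_Sop.
  by move=> h Kh; rewrite h2dotE !proj //; exact: KZ.
have KS := K_Sop Kf; have Kd := KB Kg KS.
have := gP _ Kd; rewrite h2dotE => -[h1 _]; have h2 := proj _ Kd.
have E (u : seqs) : h2sub (shiftz f) u = hcons 0 f - u by rewrite shiftzE.
rewrite !E in h1 h2.
have [Hg HS Hd] := And3 (K_H2 Kg) (K_H2 KS) (K_H2 Kd).
rewrite (rdBl Hsf Hg Hd) in h1; rewrite (rdBl Hsf HS Hd) in h2.
apply/eqP; rewrite -subr_eq0; apply/eqP/rd_eq0 => //.
by rewrite (rdBl Hg HS Hd); lra.
Qed.

Lemma Theta0E : Theta0 A = A 0%N.
Proof.
apply/matrixP => i j; rewrite mxE.
have [u0 c0] : (forall k, (1 <= k)%N -> re (A k i j * 0 ^+ k) = 0) /\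
    (forall k, (1 <= k)%N -> im (A k i j * 0 ^+ k) = 0).
  by split=> -[|k] // _; rewrite expr0n mulr0.
have hr := @series_finsupp _ (fun k => re (A k i j * 0 ^+ k)) 1 u0.
have hi := @series_finsupp _ (fun k => im (A k i j * 0 ^+ k)) 1 c0.
apply: complexP => /=.
  by rewrite (cvg_lim _ hr) // big_ord1 expr0 mulr1.
by rewrite (cvg_lim _ hi) // big_ord1 expr0 mulr1.
Qed.

Lemma top_hcst y : top (hcst y) = adj (Theta0 A) *m y.
Proof.
apply: rv_inj => x; rewrite -topP; last exact: in_H2_hcst.
have := in_H2_T x; rewrite mulTheta_hcst Theta0E => HT.
rewrite -(hcons_behead (fun k => A k *m x)) rd_hcons; [|exact: in_H20|exact: (in_H2_behead HT)].
by rewrite rd0l addr0 {2}/rv vdot_mulmx adjK.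
Qed.

Lemma mproj_hcst y : mproj (hcst y) = iotaStarD A y.
Proof.
apply/funext => k; rewrite /mproj /iotaStarD mulTheta_hcst top_hcst.
by case: k.
Qed.

Lemma hcons_split x f : hcons x f = hcons 0 f + hcst x.
Proof. by rewrite hconsD add0r addr0. Qed.

(** [iotaD A x] is the backward shift of Theta x, so pairing it with [f] is pairing Theta x with z
    f. *)
Lemma is_Diota_adjP f w : in_H2 f -> is_Diota_adj A f w <-> w = top (hcons 0 f).
Proof.
move=> Hf; have E x g : in_H2 g -> rd (iotaD A x) g = rv x (top (hcons 0 g)).
  move=> Hg; rewrite rvC -topP; last exact: in_H2_hcons.
  have := in_H2_T x; rewrite mulTheta_hcst => HT.
  have E2 : rd (hcons 0 g) (fun k => A k *m x) = rv 0 (A 0%N *m x) + rd g (iotaD A x).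
    rewrite -[X in rd _ X](hcons_behead (fun k => A k *m x)).
    exact: rd_hcons Hg (in_H2_behead HT).
  by rewrite E2 rv0l add0r rdC.
split=> [h|-> x].
  apply: rv_inj => x; rewrite rvC (rvC (top _)) -E // /rv -h h2dotE //.
rewrite h2dotE vdotE !E //; last exact: in_H2Z.
by rewrite -topZ; [rewrite hconsZ scaler0 | exact: in_H2_hcons].
Qed.

(* [C^N (+) K_Theta] is encoded as sequences [hcons x f], so that
   [sum_ip] becomes the inner product of H^2. *)
Definition Uop (Om : 'M[C]_N) x f : seqs :=
  hcons (top (hcons (Om *m x) f)) (mproj (hcons (Om *m x) f)).

(** The four blocks come from splitting [hcons (Om *m x) f] into z f and the constant Om x: [mproj]
    gives S_Theta f and [iotaStarD], while [top] gives D iota^* f and Theta(0)^* Om x. *)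
Lemma U_graphP Om p q : K p.1 ->
  U_graph A Om p q <-> hcons q.2 q.1 = Uop Om p.2 p.1.
Proof.
case: p q => [f x] [g y] /= Kf; have Hf := K_H2 Kf.
have H0 := in_H2_hcons0 Hf; have Hc := in_H2_hcst (Om *m x).
have PE : mproj (hcons (Om *m x) f) = h2add (Sop f) (iotaStarD A (Om *m x)).
  by rewrite hcons_split mprojD // mproj_hcst.
have tE : top (hcons (Om *m x) f) = top (hcons 0 f) + adj (Theta0 A) *m (Om *m x).
  by rewrite hcons_split topD // top_hcst.
rewrite /Uop PE tE; split=> [[Sx [w [/= /(S_graphP _ Kf) -> [/(is_Diota_adjP _ Hf) -> [-> ->]]]]]//|h].
exists (Sop f), (top (hcons 0 f)); split; first exact/S_graphP.
split; first exact/is_Diota_adjP.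
split; first by apply/funext => k; exact: (congr1 (fun s : seqs => s k.+1) h).
exact: (congr1 (fun s : seqs => s 0%N) h).
Qed.

Lemma sum_ipE (p q : (seqs * 'cV[C]_N)%type) : in_H2 p.1 -> in_H2 q.1 ->
  sum_ip p q = h2dot (hcons p.2 p.1) (hcons q.2 q.1).
Proof.
move=> Hp Hq; have Hiq := in_H2Z 'i%C Hq.
rewrite /sum_ip !h2dotE vdotE hconsZ (rd_hcons _ _ Hp Hq) (rd_hcons _ _ Hp Hiq).
by apply: complexP; rewrite !ReIm /= addrC.
Qed.

Lemma W_SP z : W_S A z <-> exists f, [/\ K f, rd f f = 1 & z = h2dot (Sop f) f].
Proof.
split=> [[f [g [Kf [/h2dot_norm1 f1 [/(S_graphP _ Kf) -> ->]]]]]|[f [Kf f1 ->]]].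
  by exists f; split => //; apply: f1; exact: K_H2.
exists f, (Sop f); split => //; split; first exact/h2dot_norm1/f1/K_H2.
by split => //; exact/S_graphP.
Qed.

Lemma in_H2_Uop Om x f : K f -> in_H2 (Uop Om x f).
Proof.
by move=> Kf; apply: in_H2_hcons; apply: in_H2_mproj; exact/in_H2_hcons/K_H2.
Qed.

Lemma W_UP Om z : W_U A Om z <-> exists x f, [/\ K f, rd (hcons x f) (hcons x f) = 1 &
  z = h2dot (Uop Om x f) (hcons x f)].
Proof.
split=> [[p [q [Kf [n1 [UG ->]]]]]|[x [f [Kf n1 ->]]]].
  have UE := proj1 (U_graphP _ _ Kf) UG.
  have Hf := K_H2 Kf; have HV := in_H2_hcons p.2 Hf.
  have Hq : in_H2 q.1 by have := in_H2_behead (@in_H2_Uop Om p.2 _ Kf); rewrite -UE.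
  exists p.2, p.1; split; [exact: Kf| |by rewrite sum_ipE // UE].
  by apply/(h2dot_norm1 HV); rewrite -n1 sum_ipE.
have Hf := K_H2 Kf; have HV := in_H2_hcons x Hf.
have HG := in_H2_hcons (Om *m x) Hf.
pose q : seqs * 'cV[C]_N := (mproj (hcons (Om *m x) f), top (hcons (Om *m x) f)).
exists (f, x), q; split; first exact: Kf.
split; first by rewrite sum_ipE //; exact/(h2dot_norm1 HV).
split; first by apply/U_graphP.
by rewrite sum_ipE //; exact: in_H2_mproj.
Qed.

Lemma UopD Om x y f g : K f -> K g -> Uop Om (x + y) (f + g) = Uop Om x f + Uop Om y g.
Proof.
move=> /K_H2 Hf /K_H2 Hg; rewrite /Uop mulmxDr -hconsD topD ?mprojD ?hconsD //;
  exact: in_H2_hcons.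
Qed.

Lemma UopZ Om c x f : K f -> Uop Om (c *: x) (c *: f) = c *: Uop Om x f.
Proof.
move=> /K_H2 Hf; rewrite /Uop -scalemxAr -hconsZ topZ ?mprojZ ?hconsZ //; exact: in_H2_hcons.
Qed.

Lemma rd_Uop Om x y f g : isometry_mx Om -> K f -> K g ->
  rd (Uop Om x f) (Uop Om y g) = rd (hcons x f) (hcons y g).
Proof.
move=> iOm /K_H2 Hf /K_H2 Hg.
have HG := in_H2_hcons (Om *m x) Hf; have HH := in_H2_hcons (Om *m y) Hg.
rewrite /Uop (rd_hcons _ _ (in_H2_mproj HG) (in_H2_mproj HH)) addrC rd_mproj //.
rewrite (rd_hcons _ _ Hf Hg) (rd_hcons _ _ Hf Hg); congr (_ + _).
by rewrite /rv vdot_mulmx mulmxA iOm mul1mx.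
Qed.

End ModelOperators.

(** * Completeness and the resolvent of the model operator *)

Section Completeness.
Context (R : realType) (N : nat).
Local Notation C := (complex R).
Local Notation seqs := (nat -> 'cV[C]_N).

Lemma expr_small (q e : R) : 0 <= q < 1 -> 0 < e ->
  exists n0, forall n, (n0 <= n)%N -> q ^+ n <= e.
Proof.
move=> /andP[q0 q1] e0.
have q1' : `|q| < 1 by rewrite ger0_norm.
have /cvgrPdist_lt/(_ _ e0)[n0 _ h] := cvg_expr q1'.
exists n0 => n /h /=; rewrite sub0r normrN => /ltW; apply: le_trans; exact: ler_norm.
Qed.

Lemma real_cauchy_cvg (u : nat -> R) :
  (forall e, 0 < e -> exists n0, forall n, (n0 <= n)%N -> `|u n0 - u n| < e) ->
  cvgn u.
Proof.
move=> h; apply: cauchy_cvg; apply: cauchy_exP => e /h[n0 hn].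
by exists (u n0); exists n0 => // n /= n0n; exact: hn.
Qed.

(** The limit is taken coefficientwise. A Fatou argument on finite partial sums then carries the
    Cauchy bound over to the distance from the limit. *)
Lemma H2_complete (F : nat -> seqs) : (forall n, in_H2 (F n)) ->
  (forall e, 0 < e -> exists n0, forall m n, (n0 <= m)%N -> (n0 <= n)%N ->
     rd (F m - F n) (F m - F n) <= e) ->
  exists2 f, in_H2 f & forall e, 0 < e -> exists n0, forall n, (n0 <= n)%N ->
     rd (f - F n) (f - F n) <= e.
Proof.
move=> HF cF.
have entry k i e : 0 < e -> exists n0, forall n, (n0 <= n)%N ->
    cabs2 (F n0 k i 0 - F n k i 0) < e.
  move=> e0; have [n0 h] := cF (e / 2) (divr_gt0 e0 (ltr0n _ 2)).
  exists n0 => n n0n.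
  have := h n0 n (leqnn _) n0n; have := vnorm2_coef_le k (in_H2B (HF n0) (HF n)).
  have : cabs2 (F n0 k i 0 - F n k i 0) <= vnorm2 ((F n0 - F n) k).
    rewrite /vnorm2 (bigD1 i) //= !mxE lerDl; apply: sumr_ge0 => j _; exact: cabs2_ge0.
  lra.
have cvg_part (part : C -> R) (k : nat) (i : 'I_N) :
    (forall z, part z ^+ 2 <= cabs2 z) -> (forall z w, part (z - w) = part z - part w) ->
    cvgn (fun n => part (F n k i 0)).
  move=> p2 pB; apply: real_cauchy_cvg => e e0.
  have [n0 h] := entry k i (e ^+ 2) (exprn_gt0 _ e0); exists n0 => n /h hn.
  rewrite -ltr_sqr ?nnegrE ?normr_ge0 ?(ltW e0) // real_normK ?num_real //.
  by rewrite -pB; exact: le_lt_trans hn.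
have cre k i : cvgn (fun n => re (F n k i 0)).
  by apply: cvg_part => [z|z w]; [exact: sqr_re_le | rewrite reD reN].
have cim k i : cvgn (fun n => im (F n k i 0)).
  by apply: cvg_part => [z|z w]; [exact: sqr_im_le | rewrite imD imN].
pose f : seqs := fun k => \col_i Complex (limn (fun n => re (F n k i 0)))
                                         (limn (fun n => im (F n k i 0))).
have Ff k : vcvg (fun n => F n k) (f k).
  by move=> i; rewrite mxE; split => /=; [exact: cre | exact: cim].
have main e : 0 < e -> exists n0, forall n, (n0 <= n)%N ->
    in_H2 (f - F n) /\ rd (f - F n) (f - F n) <= e.
  move=> e0; have [n0 h] := cF _ e0; exists n0 => n n0n; apply: H2_bounded => M.
  have lim : (fun m => \sum_(k < M) vnorm2 ((F m - F n) k)) @ \oo -->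
      \sum_(k < M) vnorm2 ((f - F n) k).
    elim: M => [|M IH].
      by rewrite big_ord0; under eq_fun do rewrite big_ord0; exact: cvg_cst.
    rewrite big_ord_recr /=; under eq_fun do rewrite big_ord_recr /=.
    apply: cvgD => //; apply: vcvg_vnorm2; apply: vcvgD; first exact: Ff.
    exact: vcvg_cst.
  rewrite -(cvg_lim _ lim) //; apply: limr_le; first by apply/cvg_ex; eexists; exact: lim.
  exists n0 => // m /= n0m; apply: le_trans (h m n n0m n0n).
  exact/rd_partial/in_H2B.
have Hf : in_H2 f.
  have [n0 h] := main 1 ltr01; have [h1 _] := h n0 (leqnn _).
  by have := in_H2D h1 (HF n0); rewrite subrK.
by exists f => // e /main[n0 h]; exists n0 => n /h[].
Qed.

End Completeness.

Section Resolvent.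
Local Opaque Sop rd in_H2 mulTheta.
Context (R : realType) (N : nat).
Local Notation C := (complex R).
Local Notation seqs := (nat -> 'cV[C]_N).
Context (A : nat -> 'M[C]_N).
Hypothesis innerA : inner_fn A.
Implicit Types (f g h b : seqs) (c : C).
Local Notation T := (mulTheta A).
Local Notation K := (KTheta A).
Local Notation S := (Sop A).

Lemma K_closed (F : nat -> seqs) f : (forall n, K (F n)) -> in_H2 f ->
  (forall e, 0 < e -> exists n0, forall n, (n0 <= n)%N -> rd (f - F n) (f - F n) <= e) ->
  K f.
Proof.
move=> KF Hf Ff; apply/KThetaP; split => // h Hh.
have HTh := in_H2_mulTheta innerA Hh.
(* The square is estimated, since Cauchy-Schwarz bounds it linearly by the squared distance from [f]
   to [F n]. *)
apply/eqP; rewrite -sqrf_eq0; apply/eqP/le_anti; rewrite sqr_ge0 andbT.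
apply: (@le_epsilon_lin _ _ (rd (T h) (T h))); first exact: rd_ge0.
move=> e e0; have [n0 /(_ n0 (leqnn _)) fe] := Ff _ e0.
have /KThetaP[HF FK] := KF n0.
have -> : rd f (T h) = rd (f - F n0) (T h) by rewrite rdBl // FK // subr0.
apply: le_trans (rd_CS (in_H2B Hf HF) HTh) _.
by rewrite mulrC ler_wpM2l // rd_ge0.
Qed.

Context (a zeta : C) (delta : R).
Hypothesis zeta1 : cabs2 zeta = 1.
Hypothesis delta0 : 0 < delta.
Hypothesis delta_le : delta ^+ 2 <= cabs2 a.
Hypothesis coercive : forall f, K f ->
  delta * rd f f <= rd (S f - zeta *: f) (a *: f).

Let L f : seqs := S f - zeta *: f.

Let K_L f : K f -> K (L f).
Proof. by move=> Kf; apply: KB => //; [exact: K_Sop | exact: KZ]. Qed.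

Let LD f g : in_H2 f -> in_H2 g -> L (f + g) = L f + L g.
Proof.
by move=> Hf Hg; rewrite /L SopD // scalerDr opprD addrACA.
Qed.

Let LZ (c : C) f : in_H2 f -> L (c *: f) = c *: L f.
Proof.
by rewrite /L => Hf; rewrite SopZ // [RHS]scalerBr !scalerA (mulrC zeta).
Qed.

Let LB f g : in_H2 f -> in_H2 g -> L (f - g) = L f - L g.
Proof.
move=> Hf Hg; rewrite -[in LHS](scaleN1r g) (LD Hf (in_H2Z (-1) Hg)) (LZ _ Hg).
by rewrite scaleN1r.
Qed.

Let L_bounded f : K f -> rd (L f) (L f) <= 4 * rd f f.
Proof.
move=> Kf; have Hf := K_H2 Kf.
have HS := K_H2 (K_Sop innerA Kf); have Hz := in_H2Z zeta Hf.
have := rdB_le HS Hz; have := Sop_contraction innerA Hf.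
rewrite rdZZ // zeta1 /L; lra.
Qed.

Let alpha_gt0 : 0 < cabs2 a.
Proof. by apply: lt_le_trans delta_le; exact: exprn_gt0. Qed.

(** Coercivity and Cauchy-Schwarz give delta |f|^2 <= |L f| |a| |f|; square and cancel |f|^2. This
    transfers smallness of residuals to the iterates themselves. *)
Let L_bounded_below f : K f -> delta ^+ 2 * rd f f <= cabs2 a * rd (L f) (L f).
Proof.
move=> Kf; have Hf := K_H2 Kf; have HL := K_H2 (K_L Kf).
have f0 := rd_ge0 Hf; have L0 := rd_ge0 HL.
have := rd_CS HL (in_H2Z a Hf); rewrite rdZZ // => CS.
have co := coercive Kf; rewrite -/(L f) in co.
have [fz|fnz] := eqVneq (rd f f) 0.
  by rewrite fz mulr0; apply: mulr_ge0 => //; exact: ltW.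
have fp : 0 < rd f f by rewrite lt_neqAle eq_sym fnz.
have df0 : 0 <= delta * rd f f by rewrite mulr_ge0 // ltW.
rewrite -(ler_pM2r fp); apply: le_trans (_ : (delta * rd f f) ^+ 2 <= _).
  by rewrite le_eqVlt; apply/orP; left; apply/eqP; ring.
apply: le_trans (_ : rd (L f) (a *: f) ^+ 2 <= _).
  by rewrite ler_sqr ?nnegrE //; apply: le_trans co.
by apply: le_trans CS _; rewrite le_eqVlt; apply/orP; left; apply/eqP; ring.
Qed.

(** With step eta conj(a), coercivity and |L f|^2 <= 4 |f|^2 give the factor 1 - 2 eta delta + 4
    eta^2 |a|^2. It is smallest at eta = delta / (4 |a|^2), the size used in [step], where its value
    is [q]; [delta_le] makes [q] nonnegative. *)
Let q := 1 - delta ^+ 2 / (4 * cabs2 a).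

Let q01 : 0 <= q < 1.
Proof.
have a4 : 0 < 4 * cabs2 a by rewrite mulr_gt0.
have d2 : 0 < delta ^+ 2 / (4 * cabs2 a) by rewrite divr_gt0 // exprn_gt0.
have : delta ^+ 2 / (4 * cabs2 a) <= 1.
  by rewrite ler_pdivrMr // mul1r; move: delta_le alpha_gt0; set u := _ ^+ 2; set v := cabs2 a; lra.
by move=> ?; rewrite /q; apply/andP; split; lra.
Qed.

Let step : C := Complex (delta / (4 * cabs2 a)) 0 * cconj a.

Let relax_le f : K f ->
  rd (f - step *: L f) (f - step *: L f) <= q * rd f f.
Proof.
move=> Kf; have Hf := K_H2 Kf; have HL := K_H2 (K_L Kf).
rewrite (rd_relax _ _ Hf HL).
have an0 : cabs2 a != 0 by rewrite gt_eqF.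
have eta0 : 0 < delta / (4 * cabs2 a) by rewrite divr_gt0 // mulr_gt0.
have co : _ <= _ * rd (L f) (a *: f) := ler_wpM2l (ltW eta0) (coercive Kf).
have e0 : 0 <= (delta / (4 * cabs2 a)) ^+ 2 * cabs2 a.
  by rewrite mulr_ge0 ?sqr_ge0 // ltW.
have bd := ler_wpM2l e0 (L_bounded Kf).
have -> : q * rd f f = rd f f - 2 * (delta / (4 * cabs2 a) * (delta * rd f f)) +
   (delta / (4 * cabs2 a)) ^+ 2 * cabs2 a * (4 * rd f f) by rewrite /q; field.
apply: lerD => //; rewrite lerD2l lerN2 ler_pM2l //.
Qed.

(** Relaxation for L f + b = 0: the residuals satisfy r' = r - step L r, so they shrink
    geometrically by [relax_le], and the lower bound on [L] makes the iterates Cauchy. *)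
Lemma resolvent b : K b -> exists2 f, K f & zeta *: f = S f + b.
Proof.
move=> Kb; have Hb := K_H2 Kb.
have EL f : L f = S f - zeta *: f by [].
clearbody L.
pose F := fix F n := if n is n'.+1 then F n' - step *: (L (F n') + b) else 0 : seqs.
have KF n : K (F n).
  by elim: n => [|n IH] /=; [exact: K0 | apply: KB => //; apply: KZ => //; apply: KD => //; exact: K_L].
have HF n := K_H2 (KF n).
pose r n := L (F n) + b.
have Kr n : K (r n) by apply: KD => //; exact: K_L.
have Hr n := K_H2 (Kr n).
have rS n : r n.+1 = r n - step *: L (r n).
  by rewrite {1}/r /= -/(r n) LB ?LZ //; [rewrite addrAC | exact: in_H2Z].
have r_le n : rd (r n) (r n) <= q ^+ n * rd b b.
  elim: n => [|n IH].
    rewrite expr0 mul1r /r (_ : L (F 0%N) = 0) ?add0r //.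
    by rewrite /= -[X in L X](scale0r (0 : seqs)) LZ ?scale0r //; exact: in_H20.
  rewrite rS exprS -mulrA; apply: le_trans (relax_le (Kr n)) _.
  by have /andP[q0 _] := q01; apply: ler_wpM2l.
have b0 := rd_ge0 Hb; have d2 : 0 < delta ^+ 2 by exact: exprn_gt0.
have small e : 0 < e -> exists n0, forall n, (n0 <= n)%N -> rd (r n) (r n) <= e.
  move=> e0; have e1 : 0 < e / (rd b b + 1) by apply: divr_gt0 => //; lra.
  have [n0 h] := expr_small q01 e1; exists n0 => n /h hn.
  apply: le_trans (r_le n) _; apply: le_trans (ler_wpM2r b0 hn) _.
  rewrite -mulrA ler_piMr ?(ltW e0) // mulrC ler_pdivrMr; lra.
have FB m n : delta ^+ 2 * rd (F m - F n) (F m - F n) <=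
    cabs2 a * (2 * rd (r m) (r m) + 2 * rd (r n) (r n)).
  apply: le_trans (L_bounded_below (KB innerA (KF m) (KF n))) _.
  rewrite ler_pM2l // LB //.
  have -> : L (F m) - L (F n) = r m - r n by rewrite /r opprD addrACA subrr addr0.
  exact: rdB_le.
have cauchyF e : 0 < e -> exists n0, forall m n, (n0 <= m)%N -> (n0 <= n)%N ->
    rd (F m - F n) (F m - F n) <= e.
  (* Two residuals of this size make the right side of [FB] equal to delta^2 e. *)
  move=> e0; have e1 : 0 < delta ^+ 2 * e / (4 * cabs2 a).
    by rewrite divr_gt0 ?mulr_gt0.
  have [n0 h] := small _ e1; exists n0 => m n /h hm /h hn.
  rewrite -(ler_pM2l d2); apply: le_trans (FB m n) _.
  have -> : delta ^+ 2 * e = cabs2 a * (4 * (delta ^+ 2 * e / (4 * cabs2 a))).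
    by field; rewrite gt_eqF.
  by rewrite ler_pM2l //; move: hm hn; set x := _ / _; set y := rd _ _; set z := rd _ _; lra.
have [f Hf Ff] := H2_complete HF cauchyF.
have Kf := K_closed KF Hf Ff; exists f => //.
have Kx : K (L f + b) by apply: KD => //; exact: K_L.
have x0 : L f + b = 0.
  apply: (rd_eq0 (K_H2 Kx)).
  have x_ge0 := rd_ge0 (K_H2 Kx); apply/le_anti; rewrite x_ge0 andbT.
  (* The 10 is 2 * 4 + 2: the bound 4 on |L|^2 applied to f - F n, plus the residual, each doubled
     by [rdD_le]. *)
  apply: (@le_epsilon_lin _ _ 10) => // e e0.
  have [n1 h1] := Ff _ e0; have [n2 h2] := small _ e0.
  have /h1 l1 := leq_maxl n1 n2; have /h2 l2 := leq_maxr n1 n2.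
  set n := maxn n1 n2 in l1 l2.
  have Kd := KB innerA Kf (KF n).
  have -> : L f + b = L (f - F n) + r n by rewrite LB // /r addrA subrK.
  have := rdD_le (K_H2 (K_L Kd)) (Hr n); have := L_bounded Kd; lra.
apply/eqP; rewrite -subr_eq0 -oppr_eq0 opprB; apply/eqP.
by rewrite -x0 EL addrAC.
Qed.

End Resolvent.

(** * The dilation with a prescribed eigenspace *)

Section Eigenspace.
Context (R : realType) (N : nat).
Local Notation C := (complex R).
Local Notation seqs := (nat -> 'cV[C]_N).
Context (A : nat -> 'M[C]_N).
Hypothesis innerA : inner_fn A.
Implicit Types (f g h b : seqs) (c : C) (x y : 'cV[C]_N) (M : 'M[C]_N).
Local Notation T := (mulTheta A).
Local Notation K := (KTheta A).
Local Notation S := (Sop A).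

Lemma lin_combination (H : 'I_N -> seqs) x : (forall i, in_H2 (H i)) ->
  [/\ in_H2 (\sum_i x i 0 *: H i),
      mproj A (\sum_i x i 0 *: H i) = \sum_i x i 0 *: mproj A (H i)
    & top A (\sum_i x i 0 *: H i) = \sum_i x i 0 *: top A (H i)].
Proof.
move=> HH; elim: (index_enum _) => [|i s [IH1 IH2 IH3]].
  rewrite !big_nil -[in top A 0](scale0r (0 : seqs)) -[in mproj A 0](scale0r (0 : seqs)).
  have H0 := @in_H20 R N.
  by rewrite mprojZ // topZ // !scale0r.
have Hi := in_H2Z (x i 0) (HH i).
rewrite !big_cons; split; first exact: in_H2D.
  by rewrite mprojD // IH2 mprojZ.
by rewrite topD // IH3 topZ.
Qed.

Lemma K_sum (F : 'I_N -> seqs) x : (forall i, K (F i)) -> K (\sum_i x i 0 *: F i).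
Proof.
move=> KF; elim: (index_enum _) => [|i s IH]; first by rewrite big_nil; exact: K0.
by rewrite big_cons; apply: (KD innerA) IH; exact: KZ.
Qed.

Lemma hcons_sum (F : 'I_N -> seqs) x :
  hcons x (\sum_i x i 0 *: F i) = \sum_i x i 0 *: hcons (delta_mx i 0) (F i).
Proof.
have ev (G : 'I_N -> seqs) k : (\sum_i G i) k = \sum_i G i k.
  exact: (big_morph (fun f : seqs => f k)).
apply/funext => -[|k]; rewrite ev /=; last by rewrite ev.
by rewrite {1}(matrix_sum_delta x); apply: eq_bigr => i _; rewrite big_ord1.
Qed.

Context (a zeta : C) (delta : R).
Hypothesis zeta1 : cabs2 zeta = 1.
Hypothesis delta0 : 0 < delta.
Hypothesis delta_le : delta ^+ 2 <= cabs2 a.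
Hypothesis coercive : forall f, K f ->
  delta * rd f f <= rd (S f - zeta *: f) (a *: f).

(* The unitary [Om] is chosen so that [zeta] is an eigenvalue of [Uop Om] whose
   eigenspace is the graph of [F]. *)
Lemma eigenspace_unitary : exists Om, unitary_mx Om /\
  exists F : 'cV[C]_N -> seqs, forall x, K (F x) /\ Uop A Om x (F x) = zeta *: hcons x (F x).
Proof.
have h i : exists f, K f /\ mproj A (hcons (delta_mx i 0) f) = zeta *: f.
  (* With this right-hand side, S f + b is [mproj] of z f plus the i-th basis vector. *)
  have Kb := K_mproj innerA (delta_mx i 0 : 'cV[C]_N) (K0 A).
  have [f Kf fE] := resolvent innerA zeta1 delta0 delta_le coercive Kb.
  exists f; split => //; rewrite hcons_split mprojD ?fE //; last exact: in_H2_hcst.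
  exact: (in_H2_hcons 0 (K_H2 Kf)).
have [F FP] := choice h.
have HH i : in_H2 (hcons (delta_mx i 0) (F i)).
  by apply: in_H2_hcons; exact: K_H2 (proj1 (FP i)).
(* [choice] provides no linearity, so the equation is solved on basis vectors only and extended
   linearly; this is what makes [E] a matrix. *)
pose G y : seqs := \sum_i y i 0 *: F i.
have KG y : K (G y) by apply: K_sum => i; have [] := FP i.
pose E : 'M[C]_N := \matrix_(j, i) top A (hcons (delta_mx i 0) (F i)) j 0.
have PG y : mproj A (hcons y (G y)) = zeta *: G y.
  have [_ pE _] := lin_combination y HH; rewrite hcons_sum pE scaler_sumr.
  by apply: eq_bigr => i _; have [_ ->] := FP i; rewrite !scalerA mulrC.
have TG y : top A (hcons y (G y)) = E *m y.
  have [_ _ tE] := lin_combination y HH; rewrite hcons_sum tE.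
  apply/colP => j; rewrite summxE mxE; apply: eq_bigr => i _.
  by rewrite !mxE mulrC.
(* Pythagoras reads |zeta G y|^2 + |E y|^2 = |y|^2 + |G y|^2, in polarized form, and |zeta| = 1
   cancels the [G] terms. *)
have isoE : adj E *m E = 1%:M.
  apply: mulmx_id => y; apply: rv_inj => x; rewrite -mulmxA rvC (rvC y).
  have HGx := K_H2 (KG x); have HGy := K_H2 (KG y).
  have := rd_mproj innerA (in_H2_hcons x HGx) (in_H2_hcons y HGy).
  rewrite !PG !TG rdZZ // zeta1 mul1r (rd_hcons x y HGx HGy).
  have -> : rv (E *m x) (E *m y) = rv x (adj E *m (E *m y)) by rewrite /rv vdot_mulmx.
  by rewrite addrC => /addIr.
have unE : E *m adj E = 1%:M by exact: mulmx1C.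
have zz : cconj zeta * zeta = 1 by rewrite mulcconj zeta1.
exists (zeta *: adj E); split.
  by split; rewrite adjZ adjK -scalemxAl -scalemxAr scalerA ?unE ?isoE ?zz 1?mulrC ?zz scale1r.
(* For y = Om x the dilation returns zeta G y and E y, and E y = zeta x because E (adj E) = 1. *)
exists (fun x => G ((zeta *: adj E) *m x)) => x; split; first exact: KG.
rewrite /Uop PG TG hconsZ; congr hcons.
by rewrite -!scalemxAl -scalemxAr mulmxA unE mul1mx.
Qed.

Lemma unitary_lower_bound : exists2 Om, unitary_mx Om & forall x f, K f ->
  rd (zeta *: hcons x f) (a *: hcons x f) <= rd (Uop A Om x f) (a *: hcons x f).
Proof.
have [Om [uOm [F FP]]] := eigenspace_unitary; exists Om => // x f Kf.
have [KF UF] := FP x; have iOm : isometry_mx Om by case: uOm.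
set e := hcons x (F x) in UF; pose k := f - F x; set k0 := hcons 0 k.
have Kk : K k by exact: KB.
have VE : hcons x f = e + k0 by rewrite hconsD addr0 addrC subrK.
have UE : Uop A Om x f = zeta *: e + Uop A Om 0 k.
  rewrite -UF -(UopD innerA Om x 0 KF Kk) addr0; congr Uop.
  by rewrite addrC subrK.
have He : in_H2 e by exact: in_H2_hcons (K_H2 KF).
have Hk := K_H2 Kk; have Hk0 : in_H2 k0 by exact: in_H2_hcons.
have HU : in_H2 (Uop A Om 0 k) by exact: in_H2_Uop.
have Hze := in_H2Z zeta He; have Hae := in_H2Z a He.
have Hzk := in_H2Z zeta Hk0; have Hak := in_H2Z a Hk0.
(* Since U e = zeta e with |zeta| = 1, [a *: e] is itself the image of [a * cconj zeta] times [e],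
   so isometry moves U off [k]. The other cross term already carries zeta, coming from U e. *)
have mixed : rd (Uop A Om 0 k) (a *: e) = rd (zeta *: k0) (a *: e).
  have ae : a *: e = Uop A Om ((a * cconj zeta) *: x) ((a * cconj zeta) *: F x).
    by rewrite (UopZ innerA _ _ _ KF) UF scalerA -mulrA mulcconj zeta1 mulr1.
  rewrite [in LHS]ae (rd_Uop innerA _ _ iOm Kk (KZ _ KF)) -hconsZ -/e -/k0.
  by rewrite [RHS]rdZl scalerA mulrC.
have diag : rd (Uop A Om 0 k) (a *: k0) = rd (S k) (a *: k).
  have HS : in_H2 (S k) by exact: K_H2 (K_Sop innerA Kk).
  rewrite /Uop mulmx0 hconsZ scaler0 (rd_hcons _ _ HS (in_H2Z a Hk)).
  by rewrite rvC rv0l add0r.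
have diagz : rd (zeta *: k0) (a *: k0) = rd (zeta *: k) (a *: k).
  rewrite !hconsZ !scaler0 (rd_hcons _ _ (in_H2Z zeta Hk) (in_H2Z a Hk)).
  by rewrite rv0l add0r.
have HS : in_H2 (S k) by exact: K_H2 (K_Sop innerA Kk).
have co := coercive Kk; rewrite (rdBl HS (in_H2Z zeta Hk) (in_H2Z a Hk)) in co.
have dk : 0 <= delta * rd k k by rewrite mulr_ge0 ?rd_ge0 // ltW.
rewrite UE VE !scalerDr.
have HaV := in_H2D Hae Hak.
rewrite (rdDl Hze Hzk HaV) (rdDl Hze HU HaV) lerD2l.
rewrite (rdDr Hae Hak HU) (rdDr Hae Hak Hzk).
by rewrite mixed diag diagz lerD2l -subr_ge0; exact: le_trans dk co.
Qed.

End Eigenspace.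

(** * Numerical ranges and half-planes *)

Section Planar.
Context (R : realType).
Local Notation C := (complex R).
Implicit Types (z s a : C) (S : set C).

Lemma increasing_seq_ge (phi : nat -> nat) : increasing_seq phi -> forall n, (n <= phi n)%N.
Proof.
move=> h; elim=> // n IH; apply: leq_ltn_trans IH _.
have E : (phi n.+1 <= phi n)%N = (n.+1 <= n)%N := h n.+1 n; by rewrite ltnNge E ltnn.
Qed.

Lemma ccvg_subseq_bounded (u : nat -> C) (M : R) : (forall n, cabs2 (u n) <= M) ->
  exists2 phi, increasing_seq phi & exists l, ccvg (u \o phi) l.
Proof.
move=> uM.
have bnd (v : nat -> R) : (forall n, v n ^+ 2 <= M) -> bounded_fun v.
  move=> vM; exists (Num.sqrt M); split; first exact: num_real.
  move=> x Mx n _; apply: le_trans (ltW Mx).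
  by rewrite -sqrtr_sqr ler_wsqrtr.
have [phi iphi /cvg_ex[lr hr]] := bolzano_weierstrass
  (bnd (fun n => re (u n)) (fun n => le_trans (sqr_re_le _) (uM n))).
have [psi ipsi /cvg_ex[li hi]] := bolzano_weierstrass
  (bnd (fun n => im (u (phi n))) (fun n => le_trans (sqr_im_le _) (uM _))).
exists (phi \o psi); first by move=> m n; rewrite -[RHS]ipsi -[RHS]iphi.
exists (Complex lr li); split => /=; last exact: hi.
apply: cvg_comp hr; apply/cvgnyPge => m; exists m => // n /= mn.
exact: leq_trans (increasing_seq_ge ipsi n).
Qed.

Lemma ccvg_cclosure S (u : nat -> C) l : (forall n, S (u n)) -> ccvg u l -> cclosure S l.
Proof.
move=> Su ul e e0.
have h : (fun n => cabs2 (u n - l)) @ \oo --> (0 : R).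
  by rewrite -(cabs20 R) -(subrr l); apply: ccvg_cabs2; apply: ccvgD => //; exact: ccvg_cst.
have /cvgrPdist_lt/(_ _ e0)[n _ /(_ n (leqnn n))] := h.
rewrite sub0r normrN ger0_norm ?cabs2_ge0 // => un; exists (u n); split => //.
by rewrite -cabs2N opprB.
Qed.

(* Compactness turns the strict inequality on the closure into a gap. *)
Lemma halfplane_gap S a (c : R) : (forall z, S z -> cabs2 z <= 1) ->
  (forall z, cclosure S z -> c < re (cconj a * z)) ->
  exists2 m, c < m & forall z, S z -> m <= re (cconj a * z).
Proof.
move=> S1 Sc; apply: contrapT => no.
have h (n : nat) : exists z, S z /\ re (cconj a * z) < c + harmonic n.
  apply: contrapT => hn; apply: no; exists (c + harmonic n); first by rewrite ltrDl invr_gt0.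
  by move=> z Sz; rewrite leNgt; apply/negP => zl; apply: hn; exists z.
have [u uP] := choice h.
have [phi iphi [l ul]] := @ccvg_subseq_bounded u 1 (fun n => S1 _ (proj1 (uP n))).
have Sl : cclosure S l by apply: ccvg_cclosure ul => n /=; exact: (proj1 (uP _)).
have := Sc l Sl; apply/negP; rewrite -leNgt.
have [lim _] := ccvgM (ccvg_cst (cconj a)) ul.
have lim2 : (fun n => c + @harmonic R n) @ \oo --> c.
  by rewrite -[X in _ --> X]addr0; apply: cvgD; [exact: cvg_cst | exact: cvg_harmonic].
rewrite -(cvg_lim _ lim) // -(cvg_lim _ lim2) //; apply: ler_lim.
- by apply/cvg_ex; eexists; exact: lim.
- by apply/cvg_ex; eexists; exact: lim2.
apply: nearW => n; apply: le_trans (ltW (proj2 (uP (phi n)))) _.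
by rewrite lerD2l lef_pV2 ?posrE ?ltr0n // ler_nat ltnS increasing_seq_ge.
Qed.

Lemma cclosure_ge S a (c : R) : (forall z, S z -> c <= re (cconj a * z)) ->
  forall z, cclosure S z -> c <= re (cconj a * z).
Proof.
move=> Sc z Sz; rewrite leNgt; apply/negP => zc.
have d0 : 0 < c - re (cconj a * z) by rewrite subr_gt0.
have e0 : 0 < (c - re (cconj a * z)) ^+ 2 / (cabs2 a + 1).
  by rewrite divr_gt0 ?exprn_gt0 // ltr_wpDl ?cabs2_ge0.
have [s [Ss zs]] := Sz _ e0.
have a0 := cabs2_ge0 a.
have : re (cconj a * (z - s)) ^+ 2 < (c - re (cconj a * z)) ^+ 2.
  apply: le_lt_trans (sqr_re_le _) _; rewrite cabs2M cabs2_conj.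
  have a1 : 0 < cabs2 a + 1 by lra.
  move: zs; rewrite ltr_pdivlMr //; apply: le_lt_trans.
  by rewrite mulrC ler_wpM2l ?cabs2_ge0 //; lra.
have := Sc _ Ss; rewrite mulrBr reD reN => cs.
rewrite -[X in X < _]sqrrN opprB ltr_sqr ?nnegrE; lra.
Qed.

Lemma cclosure_bounded S (M : R) : (forall z, S z -> cabs2 z <= M) -> cbounded (cclosure S).
Proof.
move=> SM; exists (2 + 2 * M) => z /(_ 1 ltr01)[s [/SM sM zs]].
by rewrite -[z](subrK s); apply: le_trans (cabs2D_le _ _) _; lra.
Qed.

(** Two steps of size [e / 8], doubled by the squared triangle inequality, total [e / 2]; this
    leaves room for the strict bound. *)
Lemma cclosure_approx S S' (e : R) : 0 < e ->
  (forall s, S s -> exists t, S' t /\ cabs2 (s - t) <= e / 8) ->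
  forall s, cclosure S s -> exists t, cclosure S' t /\ cabs2 (s - t) < e.
Proof.
move=> e0 SS' s Ss; have e8 : 0 < e / 8 by lra.
have [s' [/SS'[t [S't st]] ss']] := Ss _ e8.
exists t; split; first exact: cclosure_sub.
by rewrite -(subrKA s'); apply: le_lt_trans (cabs2D_le _ _) _; lra.
Qed.

(** The witness is chosen so that conj(a) zeta = r + i sqrt(|a|^2 - r^2), a number of modulus
    |a|. *)
Lemma unimodular_on_line a (r : R) : r ^+ 2 <= cabs2 a -> a != 0 ->
  exists2 zeta : C, cabs2 zeta = 1 & re (cconj a * zeta) = r.
Proof.
move=> ra an0; have an : cabs2 a != 0 by rewrite cabs2_eq0.
exists (Complex (r / cabs2 a) (Num.sqrt (cabs2 a - r ^+ 2) / cabs2 a) * a).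
  rewrite cabs2M [cabs2 (Complex _ _)]/cabs2 /= !expr_div_n sqr_sqrtr ?subr_ge0 //.
  by field.
by rewrite mulrCA mulcconj reM /= mulr0 subr0 divfK.
Qed.

End Planar.

Section Matrices.
Context (R : realType) (N : nat).
Local Notation C := (complex R).

Lemma cabs2_sum_le n (z : 'I_n -> C) :
  cabs2 (\sum_i z i) <= 2 ^+ n * \sum_i cabs2 (z i).
Proof.
elim: n z => [|n IH] z; first by rewrite !big_ord0 cabs20 mulr0.
rewrite !big_ord_recr /= exprS mulrDr; apply: le_trans (cabs2D_le _ _) _.
rewrite lerD //; first by rewrite -mulrA ler_pM2l.
rewrite ler_wpM2r ?cabs2_ge0 // ler_peMr // exprn_ege1 //; lra.
Qed.

Lemma vnorm2_mulmx_small : exists2 M : R, 0 < M & forall (B : 'M[C]_N) (d : R) x,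
  (forall i j, cabs2 (B i j) < d) -> vnorm2 (B *m x) <= M * d * vnorm2 x.
Proof.
(* The added 1 keeps the constant positive even for N = 0, since it is later a divisor. *)
exists (N%:R * 2 ^+ N + 1); first by rewrite ltr_wpDl ?mulr_ge0 ?exprn_ge0 //; lra.
move=> B d x Bd.
have row i : cabs2 ((B *m x) i 0) <= 2 ^+ N * (d * vnorm2 x).
  rewrite mxE; apply: le_trans (cabs2_sum_le _) _; rewrite ler_pM2l ?exprn_gt0 //.
  rewrite mulr_sumr; apply: ler_sum => j _.
  by rewrite cabs2M ler_wpM2r ?cabs2_ge0 // ltW.
apply: le_trans (_ : \sum_(i < N) 2 ^+ N * (d * vnorm2 x) <= _); first exact: ler_sum.
rewrite sumr_const card_ord -[_ *+ N]mulr_natl mulrA -[_ * d * _]mulrA.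
(* A matrix without entries does not force [d] to be nonnegative, so the empty case is separate. *)
case: N B x Bd row => [|n] B x Bd _.
  by rewrite mul0r mul0r /vnorm2 big_ord0 !mulr0.
have d0 : 0 <= d by apply: le_trans (ltW (Bd ord0 ord0)); exact: cabs2_ge0.
by rewrite mulrDl lerDl mul1r mulr_ge0 ?vnorm2_ge0.
Qed.

End Matrices.

(** * Compactness, continuity and the half-plane property of the numerical ranges *)

Section Wrapping.
Context (R : realType) (N : nat).
Local Notation C := (complex R).
Local Notation seqs := (nat -> 'cV[C]_N).
Context (A : nat -> 'M[C]_N).
Hypothesis innerA : inner_fn A.
Implicit Types (f g : seqs) (x : 'cV[C]_N) (a z : C) (Om : 'M[C]_N).
Local Notation K := (KTheta A).
Local Notation S := (Sop A).

Lemma W_S_bounded z : W_S A z -> cabs2 z <= 1.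
Proof.
move=> /(W_SP innerA)[f [Kf f1 ->]]; have Hf := K_H2 Kf.
have HS := K_H2 (K_Sop innerA Kf).
apply: le_trans (h2dot_CS HS Hf) _; rewrite f1 mulr1 -f1.
exact: Sop_contraction.
Qed.

Lemma W_U_bounded Om z : isometry_mx Om -> W_U A Om z -> cabs2 z <= 1.
Proof.
move=> iOm /(W_UP innerA)[x [f [Kf f1 ->]]].
have HV := in_H2_hcons x (K_H2 Kf).
have HU : in_H2 (Uop A Om x f) := in_H2_Uop innerA Kf.
by apply: le_trans (h2dot_CS HU HV) _; rewrite f1 mulr1 (rd_Uop innerA _ _ iOm Kf Kf) f1.
Qed.

Lemma exists_unit_vector : (0 < N)%N -> exists x : 'cV[C]_N, vnorm2 x = 1.
Proof.
case: N => // n _; exists (delta_mx ord0 0); rewrite /vnorm2 (bigD1 ord0) //= big1.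
  by rewrite mxE eqxx cabs21 addr0.
by move=> i /negbTE i0; rewrite mxE i0 cabs20.
Qed.

Lemma W_U_nonempty Om : (0 < N)%N -> exists z, W_U A Om z.
Proof.
move=> /exists_unit_vector[x x1]; eexists; apply/(W_UP innerA).
exists x, 0; split; [exact: K0 | by rewrite rd_hcst -vnorm2E | reflexivity].
Qed.

(** By linearity the [f] parts cancel, leaving the pair ([mproj], [top]) of the constant (Om - Om')
    x, which is isometric by [rd_mproj]. *)
Lemma Uop_diff Om Om' x f : K f ->
  rd (Uop A Om x f - Uop A Om' x f) (Uop A Om x f - Uop A Om' x f) =
  vnorm2 ((Om - Om') *m x).
Proof.
move=> Kf; have Hf := K_H2 Kf.
set y := (Om - Om') *m x.
have Hy := in_H2_hcst y; have H' := in_H2_hcons (Om' *m x) Hf.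
have GE : hcons (Om *m x) f = hcst y + hcons (Om' *m x) f.
  by rewrite hconsD add0r /y mulmxBl subrK.
have -> : Uop A Om x f - Uop A Om' x f = hcons (top A (hcst y)) (mproj A (hcst y)).
  rewrite /Uop GE (topD innerA Hy H') (mprojD innerA Hy H') -hconsD.
  by rewrite addrK.
have HP := in_H2_mproj innerA Hy.
rewrite (rd_hcons _ _ HP HP) addrC (rd_mproj innerA Hy Hy) rd_hcst.
by rewrite vnorm2E.
Qed.

Local Opaque Uop Sop rd h2dot.

(** The same unit vector serves both dilations, because their domain does not depend on the
    parameter. *)
Lemma W_U_close (M d e : R) Om Om' z :
  (forall (B : 'M[C]_N) (d : R) x,
    (forall i j, cabs2 (B i j) < d) -> vnorm2 (B *m x) <= M * d * vnorm2 x) ->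
  0 <= M * d <= e -> (forall i j, cabs2 (Om i j - Om' i j) < d) ->
  W_U A Om z -> exists z', W_U A Om' z' /\ cabs2 (z - z') <= e.
Proof.
move=> MP /andP[Md0 Mde] close /(W_UP innerA)[x [f [Kf f1 ->]]].
have Hf := K_H2 Kf; have HV := in_H2_hcons x Hf.
have HU : in_H2 (Uop A Om x f) := in_H2_Uop innerA Kf.
have HU' : in_H2 (Uop A Om' x f) := in_H2_Uop innerA Kf.
exists (h2dot (Uop A Om' x f) (hcons x f)); split.
  by apply/(W_UP innerA); exists x, f.
rewrite -(h2dotBl HU HU' HV).
apply: le_trans (h2dot_CS (in_H2B HU HU') HV) _.
rewrite f1 mulr1 (Uop_diff _ _ _ Kf).
have x1 : vnorm2 x <= 1.
  by move: f1; rewrite (rd_hcons _ _ Hf Hf) -vnorm2E => <-; rewrite lerDl rd_ge0.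
apply: le_trans (MP _ d x _) _; first by move=> i j; rewrite !mxE.
by apply: le_trans Mde; rewrite ler_piMr.
Qed.

Lemma W_U_continuous Om (e : R) : 0 < e ->
  exists d : R, 0 < d /\ forall Om', (forall i j, cabs2 (Om i j - Om' i j) < d) ->
    hausdorff_close (cclosure (W_U A Om)) (cclosure (W_U A Om')) e.
Proof.
move=> e0; have [M M0 MP] := @vnorm2_mulmx_small R N.
(* Chosen so that M d = [e / 8], the tolerance of [cclosure_approx]. *)
exists (e / (8 * M)); split; first by rewrite divr_gt0 ?mulr_gt0.
move=> Om' close.
have Md : 0 <= M * (e / (8 * M)) <= e / 8.
  have -> : M * (e / (8 * M)) = e / 8 by field; rewrite gt_eqF.
  by apply/andP; split; lra.
split; first by apply: cclosure_approx => // s; exact: (W_U_close MP Md close).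
have close' i j : cabs2 (Om' i j - Om i j) < e / (8 * M).
  by rewrite -cabs2N opprB.
move=> t Wt.
have [s [Ws st]] := cclosure_approx e0 (fun z => W_U_close (z := z) MP Md close') Wt.
by exists s; split => //; rewrite -cabs2N opprB.
Qed.

(* If [K_Theta] were zero then [Theta(0)] would attain its norm on [C^N]. *)
Lemma K_nontrivial : (0 < N)%N -> pure_fn A -> exists2 f, K f & 0 < rd f f.
Proof.
move=> /exists_unit_vector[x x1] pureA.
have Kf := K_mproj innerA x (K0 A); have Hf := K_H2 Kf.
exists (mproj A (hcst x)) => //; rewrite lt_neqAle rd_ge0 // andbT eq_sym.
apply/eqP => fz; have f0 := rd_eq0 Hf fz.
have := rd_mproj innerA (in_H2_hcst x) (in_H2_hcst x).
rewrite fz add0r rd_hcst -!vnorm2E x1 (top_hcst innerA) => u1.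
have := congr1 (fun g : seqs => g 0%N) f0; rewrite (mproj_hcst innerA) /iotaStarD.
rewrite -(Theta0E A) => /eqP; rewrite subr_eq0 => /eqP xE.
have u0 : adj (Theta0 A) *m x != 0.
  by apply/eqP => uz; move: u1; rewrite uz vnorm20 => /eqP; rewrite eq_sym oner_eq0.
by have := pureA _ u0; rewrite -xE u1 x1 ltxx.
Qed.

Lemma W_S_homogeneous a (m : R) : (forall z, W_S A z -> m <= re (cconj a * z)) ->
  forall f, K f -> m * rd f f <= rd (S f) (a *: f).
Proof.
move=> Wm f Kf; have Hf := K_H2 Kf; have HS := K_H2 (K_Sop innerA Kf).
have f0 := rd_ge0 Hf.
have [fz|fnz] := eqVneq (rd f f) 0.
  have -> : f = 0 by exact: rd_eq0.
  by rewrite scaler0 !rd0r mulr0.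
have fp : 0 < rd f f by rewrite lt_neqAle eq_sym fnz.
pose c : C := Complex (Num.sqrt (rd f f))^-1 0.
have c2 : cabs2 c = (rd f f)^-1.
  by rewrite /c /cabs2 /= expr0n addr0 exprVn sqr_sqrtr.
have Kg := KZ c Kf; have Hg := K_H2 Kg.
have g1 : rd (c *: f) (c *: f) = 1 by rewrite rdZZ // c2 mulVf.
have Wg : W_S A (h2dot (S (c *: f)) (c *: f)) by apply/(W_SP innerA); exists (c *: f).
have := Wm _ Wg; rewrite (h2dot_re_conj a (K_H2 (K_Sop innerA Kg)) Hg).
rewrite (SopZ innerA c Hf) scalerA mulrC -scalerA (rdZZ c HS (in_H2Z a Hf)) c2.
by rewrite mulrC ler_pdivlMr.
Qed.

Lemma W_U_halfplane a (c : R) : (0 < N)%N -> pure_fn A -> a != 0 ->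
  (forall z, cclosure (W_S A) z -> c < re (cconj a * z)) ->
  exists2 Om, unitary_mx Om & forall z, cclosure (W_U A Om) z -> c < re (cconj a * z).
Proof.
move=> N0 pureA a0 Wc.
have [m cm Wm] := halfplane_gap W_S_bounded Wc.
have Sm := W_S_homogeneous Wm.
pose alpha := Num.sqrt (cabs2 a).
have a2 : alpha ^+ 2 = cabs2 a by rewrite sqr_sqrtr // cabs2_ge0.
have alpha0 : 0 < alpha by rewrite sqrtr_gt0 cabs2_gt0.
have ball z : cabs2 z <= 1 -> - alpha <= re (cconj a * z) <= alpha.
  move=> z1; rewrite -ler_norml; apply: le_trans (re_conjM_le _ _) _.
  by rewrite ler_wsqrtr // ler_piMr // cabs2_ge0.
suff [Om uOm [r cr Wr]] : exists2 Om, unitary_mx Om &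
    exists2 r, c < r & forall z, W_U A Om z -> r <= re (cconj a * z).
  by exists Om => // z /(cclosure_ge Wr); exact: lt_le_trans.
(* In the first case the half-plane contains the closed unit disk, hence the numerical range of
   every contraction. *)
have [calpha|alphac] := ltP c (- alpha).
  have adj1 : adj 1%:M = 1%:M :> 'M[C]_N.
    by apply/matrixP => i j; rewrite !mxE eq_sym; case: (_ == _); rewrite ?cconj1 ?cconj0.
  exists 1%:M; first by rewrite /unitary_mx adj1 mulmx1.
  exists (- alpha) => // z Wz.
  have i1 : isometry_mx (1%:M : 'M[C]_N) by rewrite /isometry_mx adj1 mulmx1.
  by have /ball/andP[] := W_U_bounded i1 Wz.
(* A nonzero f in [K] gives m |f|^2 <= Re <S f, a f> <= |a| |f|^2. *)
have malpha : m <= alpha.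
  have [f Kf f0] := K_nontrivial N0 pureA; have Hf := K_H2 Kf.
  have HS := K_H2 (K_Sop innerA Kf).
  rewrite -(ler_pM2r f0); apply: le_trans (Sm _ Kf) _.
  apply: le_trans (ler_norm _) _.
  rewrite -ler_sqr ?nnegrE ?normr_ge0 ?mulr_ge0 ?(ltW alpha0) ?(ltW f0) //.
  rewrite real_normK ?num_real //; apply: le_trans (rd_CS HS (in_H2Z a Hf)) _.
  rewrite rdZZ // exprMn a2 [rd f f ^+ 2]expr2 [X in X <= _]mulrCA ler_wpM2l ?cabs2_ge0 //.
  by rewrite ler_wpM2r ?(ltW f0) //; exact: Sop_contraction.
(* As -|a| <= c < m <= |a|, both the midpoint [r] and the half-gap [delta] have modulus at most |a|:
   the first places [zeta] on the circle, the second makes the relaxation factor nonnegative. *)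
pose r := (c + m) / 2; pose delta := m - r.
have delta0 : 0 < delta by rewrite /delta /r; lra.
have ra : r ^+ 2 <= cabs2 a by rewrite -a2 /r; nra.
have delta_le : delta ^+ 2 <= cabs2 a by rewrite -a2 /delta /r; nra.
have [zeta zeta1 zetar] := unimodular_on_line ra a0.
have coercive f : K f -> delta * rd f f <= rd (S f - zeta *: f) (a *: f).
  move=> Kf; have Hf := K_H2 Kf; have HS := K_H2 (K_Sop innerA Kf).
  rewrite (rdBl HS (in_H2Z zeta Hf) (in_H2Z a Hf)) (rdZZ_self zeta a Hf) zetar.
  by rewrite mulrBl lerD2r; exact: Sm.
have [Om uOm OmP] := unitary_lower_bound innerA zeta1 delta0 delta_le coercive.
exists Om => //; exists r; first by rewrite /r; lra.
move=> z /(W_UP innerA)[x [f [Kf f1 ->]]]; have HV := in_H2_hcons x (K_H2 Kf).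
have HU : in_H2 (Uop A Om x f) := in_H2_Uop innerA Kf.
rewrite (h2dot_re_conj a HU HV); apply: le_trans (OmP x f Kf).
by rewrite (rdZZ_self zeta a HV) zetar f1 mulr1.
Qed.

End Wrapping.

Theorem theorem4p6 (R : realType) (N : nat) (A : nat -> 'M[complex R]_N) :
  (0 < N)%N -> inner_fn A -> pure_fn A ->
  wraps (fun Om => cclosure (W_U A Om)) (cclosure (W_S A)).
Proof.
move=> N0 innerA pureA; split=> [Om [iOm _]|].
  split; first by have [z Wz] := W_U_nonempty innerA Om N0; exists z; exact: cclosure_sub.
  split; last exact: cclosureK.
  by apply: (@cclosure_bounded _ _ 1) => z; exact: W_U_bounded.
split=> [Om _ e e0|Hp [a [c [a0 ->]]] WS].
  have [d [d0 dP]] := W_U_continuous innerA Om e0.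
  by exists d; split => // Om' _; exact: dP.
by have [Om uOm WU] := W_U_halfplane innerA N0 pureA a0 WS; exists Om.
Qed.
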